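(* Let $\{\rho_n\}$ be a sequence in $[-1,1]$, put $\lambda_n=\left(\tfrac12 b_n^2(1-\rho_n)\right)^{1/2}$, and suppose that for some $\lambda\in(0,\infty)$ and some $\alpha,\beta\in\mathbb{R}$ $$\lim_{n\to\infty} b_n^2\,\delta_n=\beta,\qquad\text{where } \delta_n=b_n^2(\lambda-\lambda_n)-\alpha .$$ Then for all $x,y\in\mathbb{R}$ $$\lim_{n\to\infty} b_n^2\Big(b_n^2\big(F_{\rho_n}^n(u_n(x),u_n(y))-H_\lambda(x,y)\big)-\kappa(\alpha,\lambda,x,y)H_\lambda(x,y)\Big)=\left(\tau(\alpha,\beta,\lambda,x,y)+\frac12\kappa^2(\alpha,\lambda,x,y)\right)H_\lambda(x,y),$$ where $\kappa$ and $\tau$ are the explicit functions given in the context.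
   Context: $\Phi$ is the standard normal $N(0,1)$ distribution function, $\varphi=\Phi'$ its density, and $\overline\Phi=1-\Phi$. The constant $b_n$ is defined by $n(1-\Phi(b_n))=1$, and $u_n(z)=b_n+z/b_n$ for $z\in\mathbb{R}$ (for $n\ge 3$, so that $b_n>0$). For $\rho\in[-1,1]$, $F_\rho$ is the joint distribution function of a bivariate Gaussian vector with zero means, unit variances and correlation $\rho$; $F_\rho^n$ is its $n$-th power. For $\lambda\in(0,\infty)$, $$H_{\lambda}(x,y)=\exp\left(-\Phi\left(\lambda+\frac{y-x}{2\lambda}\right)e^{-x}-\Phi\left(\lambda+\frac{x-y}{2\lambda}\right)e^{-y}\right).$$ With $s(z)=\tfrac12(z^2+2z)e^{-z}$, $$\kappa(\alpha,\lambda,x,y)=s(x)\Phi\left(\lambda+\frac{y-x}{2\lambda}\right)+s(y)\Phi\left(\lambda+\frac{x-y}{2\lambda}\right)+\big(2\alpha-\lambda(\lambda^2+x+y+2)\big)e^{-x}\varphi\left(\lambda+\frac{y-x}{2\lambda}\right).$$ The function $\tau$ is $$\tau(\alpha,\beta,\lambda,x,y)=-\tfrac18(x^4+4x^3+8x^2+16x)e^{-x}+\tau_1(\alpha,\beta,\lambda,x,y)+\tau_2(\alpha,\lambda,x,y)-\tau_3(\lambda,x,y),$$ where $$\begin{aligned}\tau_1&=(2\lambda^8+8\lambda^6-4\lambda^6x+2\lambda^4x^2-4\lambda^4x-8\alpha\lambda^3+4\alpha\lambda x)e^{-x}\,\overline\Phi\left(\lambda+\tfrac{y-x}{2\lambda}\right)\\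 &\quad+\Big(2\beta+9\alpha\lambda^2-\tfrac{23}{4}\lambda^5-\tfrac38\lambda^3xy-\alpha\lambda^2x+\tfrac34\alpha y^2-\tfrac14\alpha^2\lambda^{-3}y^2-\tfrac14\alpha^2\lambda^{-3}x^2-\alpha\lambda^2y-\tfrac14\alpha x^2-\tfrac74\lambda^7\\ &\qquad+\tfrac72\lambda^5x-\tfrac1{16}\lambda^3x^2-\alpha\lambda^4+\alpha^2\lambda+\tfrac32\lambda^5y-\tfrac9{16}\lambda^3y^2-\tfrac12\alpha xy+\tfrac12\alpha^2\lambda^{-3}xy\Big)e^{-x}\varphi\left(\lambda+\tfrac{y-x}{2\lambda}\right),\end{aligned}$$ $$\begin{aligned}\tau_2&=(2\lambda^4-4\alpha\lambda x-2\lambda^2x+8\lambda^6x-5\lambda^4x^2+10\lambda^4x+\lambda^2x^3+8\alpha\lambda^3-4\lambda^8-16\lambda^6)e^{-x}\,\overline\Phi\left(\lambda+\tfrac{y-x}{2\lambda}\right)\\ &\quad+\Big(2\alpha+4\lambda^7+12\lambda^5-3\lambda^3-6\lambda^5x+2\lambda^3x^2-\alpha y^2+2\lambda^3xy-2\lambda^5y+\tfrac32\lambda^3y^2-8\alpha\lambda^2\Big)e^{-x}\varphi\left(\lambda+\tfrac{y-x}{2\lambda}\right),\end{aligned}$$ $$\begin{aligned}\tau_3&=\tfrac18(y^4+4y^3+8y^2+16y)e^{-y}\,\Phi\left(\lambda+\tfrac{x-y}{2\lambda}\right)\\ &\quad+\Big(4\lambda^6x-3\lambda^4x^2+\lambda^2x^3-2\lambda^8-8\lambda^6-\tfrac18x^4-2\lambda^2x-\tfrac12x^3+2\lambda^4+6\lambda^4x-x^2-2x\Big)e^{-x}\,\overline\Phi\left(\lambda+\tfrac{y-x}{2\lambda}\right)\\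 &\quad+\Big(2\lambda^7-\tfrac14\lambda x^3-\lambda^5y+\tfrac12\lambda^3y^2+\lambda^3xy-3\lambda^5x+\tfrac32\lambda^3x^2-\tfrac14\lambda y^3-\tfrac14\lambda y^2x-\tfrac14\lambda yx^2-\lambda^3y-\lambda y^2-\lambda xy\\ &\qquad-\lambda^3x-\lambda x^2-4\lambda^3+6\lambda^5-2\lambda x-2\lambda y-4\lambda\Big)e^{-x}\varphi\left(\lambda+\tfrac{y-x}{2\lambda}\right).\end{aligned}$$ *)

(* Defs.v *)
From HB Require Import structures.
From mathcomp Require Import all_boot all_order all_algebra.
From mathcomp Require Import all_classical all_reals all_analysis.
Set Implicit Arguments.
Unset Strict Implicit.
Unset Printing Implicit Defensive.
Import Order.TTheory GRing.Theory Num.Theory.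
Import numFieldNormedType.Exports.
Local Open Scope classical_set_scope.
Local Open Scope ring_scope.

Definition Phi {R : realType} (x : R) : R :=
  fine (normal_prob (0 : R) 1 `]-oo, x]).

Definition Phibar {R : realType} (x : R) : R := 1 - Phi x.

Definition phi {R : realType} (x : R) : R := normal_pdf 0 1 x.

(* The centred bivariate Gaussian law with unit variances and correlation rho,
   as the law of (Z1, rho Z1 + sqrt (1 - rho^2) Z2) for Z1, Z2 independent
   N(0,1); this covers the degenerate cases rho = 1 and rho = -1. *)
Definition bigauss {R : realType} (rho : R) : set (R * R) -> \bar R :=
  pushforward
    (normal_prob (0 : R) 1 \x normal_prob (0 : R) 1)%E
    (fun z : R * R => (z.1, rho * z.1 + Num.sqrt (1 - rho ^+ 2) * z.2)).

Definition bigauss_cdf {R : realType} (rho x y : R) : R :=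
  fine (bigauss rho (`]-oo, x] `*` `]-oo, y])).

Definition u_seq {R : realType} (b : nat -> R) (n : nat) (z : R) : R :=
  b n + z / b n.

Definition lambda_seq {R : realType} (b rho : nat -> R) (n : nat) : R :=
  Num.sqrt (2^-1 * b n ^+ 2 * (1 - rho n)).

Definition delta_seq {R : realType} (b rho : nat -> R) (alpha lam : R)
    (n : nat) : R :=
  b n ^+ 2 * (lam - lambda_seq b rho n) - alpha.

Definition H {R : realType} (lam x y : R) : R :=
  expR (- Phi (lam + (y - x) / (2 * lam)) * expR (- x)
        - Phi (lam + (x - y) / (2 * lam)) * expR (- y)).

Definition s {R : realType} (z : R) : R :=
  1 / 2 * (z ^+ 2 + 2 * z) * expR (- z).

Definition kappa {R : realType} (alpha lam x y : R) : R :=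
  s x * Phi (lam + (y - x) / (2 * lam))
  + s y * Phi (lam + (x - y) / (2 * lam))
  + (2 * alpha - lam * (lam ^+ 2 + x + y + 2)) * expR (- x)
    * phi (lam + (y - x) / (2 * lam)).

Definition tau1 {R : realType} (alpha beta lam x y : R) : R :=
  (2 * lam ^+ 8 + 8 * lam ^+ 6 - 4 * lam ^+ 6 * x + 2 * lam ^+ 4 * x ^+ 2
   - 4 * lam ^+ 4 * x - 8 * alpha * lam ^+ 3 + 4 * alpha * lam * x)
  * expR (- x) * Phibar (lam + (y - x) / (2 * lam))
  + (2 * beta + 9 * alpha * lam ^+ 2 - 23 / 4 * lam ^+ 5
     - 3 / 8 * lam ^+ 3 * x * y - alpha * lam ^+ 2 * x
     + 3 / 4 * alpha * y ^+ 2
     - 1 / 4 * alpha ^+ 2 * lam ^- 3 * y ^+ 2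
     - 1 / 4 * alpha ^+ 2 * lam ^- 3 * x ^+ 2
     - alpha * lam ^+ 2 * y - 1 / 4 * alpha * x ^+ 2
     - 7 / 4 * lam ^+ 7 + 7 / 2 * lam ^+ 5 * x
     - 1 / 16 * lam ^+ 3 * x ^+ 2 - alpha * lam ^+ 4
     + alpha ^+ 2 * lam + 3 / 2 * lam ^+ 5 * y
     - 9 / 16 * lam ^+ 3 * y ^+ 2 - 1 / 2 * alpha * x * y
     + 1 / 2 * alpha ^+ 2 * lam ^- 3 * x * y)
    * expR (- x) * phi (lam + (y - x) / (2 * lam)).

Definition tau2 {R : realType} (alpha lam x y : R) : R :=
  (2 * lam ^+ 4 - 4 * alpha * lam * x - 2 * lam ^+ 2 * x
   + 8 * lam ^+ 6 * x - 5 * lam ^+ 4 * x ^+ 2 + 10 * lam ^+ 4 * x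
   + lam ^+ 2 * x ^+ 3 + 8 * alpha * lam ^+ 3 - 4 * lam ^+ 8
   - 16 * lam ^+ 6)
  * expR (- x) * Phibar (lam + (y - x) / (2 * lam))
  + (2 * alpha + 4 * lam ^+ 7 + 12 * lam ^+ 5 - 3 * lam ^+ 3
     - 6 * lam ^+ 5 * x + 2 * lam ^+ 3 * x ^+ 2 - alpha * y ^+ 2
     + 2 * lam ^+ 3 * x * y - 2 * lam ^+ 5 * y
     + 3 / 2 * lam ^+ 3 * y ^+ 2 - 8 * alpha * lam ^+ 2)
    * expR (- x) * phi (lam + (y - x) / (2 * lam)).

Definition tau3 {R : realType} (lam x y : R) : R :=
  1 / 8 * (y ^+ 4 + 4 * y ^+ 3 + 8 * y ^+ 2 + 16 * y) * expR (- y)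
  * Phi (lam + (x - y) / (2 * lam))
  + (4 * lam ^+ 6 * x - 3 * lam ^+ 4 * x ^+ 2 + lam ^+ 2 * x ^+ 3
     - 2 * lam ^+ 8 - 8 * lam ^+ 6 - 1 / 8 * x ^+ 4
     - 2 * lam ^+ 2 * x - 1 / 2 * x ^+ 3 + 2 * lam ^+ 4
     + 6 * lam ^+ 4 * x - x ^+ 2 - 2 * x)
    * expR (- x) * Phibar (lam + (y - x) / (2 * lam))
  + (2 * lam ^+ 7 - 1 / 4 * lam * x ^+ 3 - lam ^+ 5 * y
     + 1 / 2 * lam ^+ 3 * y ^+ 2 + lam ^+ 3 * x * y
     - 3 * lam ^+ 5 * x + 3 / 2 * lam ^+ 3 * x ^+ 2
     - 1 / 4 * lam * y ^+ 3 - 1 / 4 * lam * y ^+ 2 * x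
     - 1 / 4 * lam * y * x ^+ 2 - lam ^+ 3 * y - lam * y ^+ 2
     - lam * x * y - lam ^+ 3 * x - lam * x ^+ 2 - 4 * lam ^+ 3
     + 6 * lam ^+ 5 - 2 * lam * x - 2 * lam * y - 4 * lam)
    * expR (- x) * phi (lam + (y - x) / (2 * lam)).

Definition tau {R : realType} (alpha beta lam x y : R) : R :=
  - (1 / 8) * (x ^+ 4 + 4 * x ^+ 3 + 8 * x ^+ 2 + 16 * x) * expR (- x)
  + tau1 alpha beta lam x y + tau2 alpha lam x y - tau3 lam x y.

(* Main.v *)
(* Put eps = b_n^-2, u = b_n + x / b_n and v = b_n + y / b_n.  By Plackett's
   identity the derivative of F_r(u, v) in r is the bivariate normal density.
   Along r = 1 - 2 m^2 eps the derivative in m of (b_n / phi(b_n)) (1 - F_r(u, v))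
   is elementary, namely
     2 e^-x phi(m + (y - x) / (2 m)) (1 - w)^(-1/2) exp (- eps S / (1 - w))
   with w = m^2 eps and S = (m^2 + (x + y) / 2)^2 / 2.  Its expansion in eps has
   an error O(eps^3) uniform in 0 < m <= b_n / sqrt 2, and each coefficient has a
   closed antiderivative.  At m = b_n / sqrt 2 we have r = 0, so F_r factors and
   the asymptotic series of the Mills ratio applies; the mean value theorem carries
   the expansion from there to m = lambda_n.  What remains is the algebra
   of second-order expansions in eps. *)
Require Import Defs.
From mathcomp Require Import all_boot all_order all_algebra.
From mathcomp Require Import all_classical all_reals all_analysis measurable_realfun.
From mathcomp Require Import ring lra.
Import Order.TTheory GRing.Theory Num.Theory.
Import numFieldNormedType.Exports.
Local Open Scope classical_set_scope.
Local Open Scope ring_scope.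

Set Implicit Arguments.
Unset Strict Implicit.
Unset Printing Implicit Defensive.

(** Following the path from r = 0 avoids the degenerate law at r = 1 and the singular quotient (y -
    x) / (2 m) at m = 0. The price is a path of length of order b_n, and this fixes the accuracy
    needed: a uniform error O(eps^3) accumulates to O(b_n^-5) = o(eps^2). Uniformity is the delicate
    point, since the coefficients of the expansion grow polynomially in m; the Gaussian factor phi(m
    + (y - x) / (2 m)) compensates for this. The constants of integration take care of themselves:
    at m = b_n / sqrt 2 the [phi] and [Phibar] parts of the antiderivatives are smaller than every
    power of eps, and what remains is the expansion of the univariate tails. The normalization n (1
    - Phi(b_n)) = 1 acts twice. It turns n (1 - F) into a quotient of two tails with the common
    scaling b_n / phi(b_n), and it makes 1 / n smaller than every power of eps, so that passing from
    n (1 - F) to F^n adds no correction at second order. *)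

(* [is_derive] is a class; this alias keeps instance resolution from
   filling in derivative values that should be computed by unification. *)
Definition has_deriv (R : realType) (f : R -> R) (x d : R) : Prop :=
  is_derive x 1 f d.

(** * Derivative rules and the mean value theorem *)

Lemma has_deriv_add (R : realType) (f g : R -> R) (x a b : R) :
  has_deriv f x a -> has_deriv g x b ->
  has_deriv (fun t => f t + g t) x (a + b).
Proof. by move=> fa gb; exact: is_deriveD. Qed.

Lemma has_deriv_opp (R : realType) (f : R -> R) (x a : R) :
  has_deriv f x a -> has_deriv (fun t => - f t) x (- a).
Proof. by move=> fa; exact: is_deriveN. Qed.

Lemma has_deriv_mul (R : realType) (f g : R -> R) (x a b : R) :
  has_deriv f x a -> has_deriv g x b ->
  has_deriv (fun t => f t * g t) x (a * g x + f x * b).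
Proof.
move=> fa gb; refine (is_derive_eq (is_deriveM fa gb) _).
by rewrite /GRing.scale/= addrC (mulrC a).
Qed.

Lemma has_deriv_inv (R : realType) (f : R -> R) (x a : R) :
  f x != 0 -> has_deriv f x a ->
  has_deriv (fun t => (f t)^-1) x (- a / f x ^+ 2).
Proof.
move=> fx0 fa; refine (is_derive_eq (is_deriveV fx0 fa) _).
by rewrite /GRing.scale/= mulrC !mulrN mulNr.
Qed.

Lemma has_deriv_pow (R : realType) (f : R -> R) (n : nat) (x a : R) :
  has_deriv f x a ->
  has_deriv (fun t => f t ^+ n) x (n%:R * f x ^+ n.-1 * a).
Proof.
move=> fa; have -> : (fun t => f t ^+ n) = f ^+ n by rewrite exprfctE.
exact: is_deriveX.
Qed.

Lemma has_deriv_const (R : realType) (k x : R) :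
  has_deriv (fun=> k : R) x (0 : R).
Proof. exact: is_derive_cst. Qed.

Lemma has_deriv_var (R : realType) (x : R) : has_deriv (fun t : R => t) x (1 : R).
Proof. exact: is_derive_id. Qed.

Lemma has_deriv_compose (R : realType) (f g : R -> R) (x a b : R) :
  has_deriv f (g x) a -> has_deriv g x b ->
  has_deriv (fun t => f (g t)) x (a * b).
Proof. by move=> fa gb; exact: is_derive1_comp. Qed.

Lemma has_deriv_exp (R : realType) (f : R -> R) (x a : R) :
  has_deriv f x a ->
  has_deriv (fun t => expR (f t)) x (expR (f x) * a).
Proof. by move=> fa; exact: (has_deriv_compose (is_derive_expR _) fa). Qed.

Lemma has_deriv_conv (R : realType) (f : R -> R) (x a b : R) :
  has_deriv f x a -> a = b -> has_deriv f x b.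
Proof. by move=> ? <-. Qed.

Lemma has_deriv_continuous (R : realType) (f : R -> R) (x a : R) :
  has_deriv f x a -> {for x, continuous f}.
Proof.
by move=> [fa _]; exact/differentiable_continuous/derivable1_diffP.
Qed.

Lemma has_deriv_within_continuous (R : realType) (f df : R -> R) (a b : R) :
  (forall t, a <= t <= b -> has_deriv f t (df t)) ->
  {within `[a, b], continuous f}.
Proof.
move=> h; apply: derivable_within_continuous => t; rewrite in_itv/= => tab.
by have [] := h t tab.
Qed.

Lemma mean_value (R : realType) (f df : R -> R) (a b : R) : a <= b ->
  (forall t, a <= t <= b -> has_deriv f t (df t)) ->
  exists2 c, a <= c <= b & f b - f a = df c * (b - a).
Proof.
move=> ab h.
have [||c ci E] := @MVT_segment R f df a b ab.
- move=> t; rewrite in_itv/= => /andP[at_ tb].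
  by apply: h; rewrite !ltW.
- exact: has_deriv_within_continuous h.
by exists c => //; move: ci; rewrite in_itv.
Qed.

Lemma le_of_derive_le (R : realType) (f g df dg : R -> R) (a b : R) : a <= b ->
  (forall t, a <= t <= b -> has_deriv f t (df t)) ->
  (forall t, a <= t <= b -> has_deriv g t (dg t)) ->
  (forall t, a <= t <= b -> df t <= dg t) ->
  f b - f a <= g b - g a.
Proof.
move=> ab hf hg le.
have [|c cab E] := @mean_value R (fun t => g t + - f t) (fun t => dg t + - df t) a b ab.
  by move=> t tab; apply: has_deriv_add; [exact: hg|exact/has_deriv_opp/hf].
rewrite -subr_ge0 (_ : _ - _ = (g b - f b) - (g a - f a)); last by ring.
by rewrite E mulr_ge0 ?subr_ge0// le.
Qed.

Ltac derive := repeat first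
  [ eassumption | apply: has_deriv_const | apply: has_deriv_exp
  | apply: has_deriv_var | apply: has_deriv_add | apply: has_deriv_opp
  | apply: has_deriv_mul | apply: has_deriv_inv | apply: has_deriv_pow ].

(** * The standard normal density and distribution function *)

Lemma phiE (R : realType) (t : R) :
  phi t = normal_peak 1 * expR (- t ^+ 2 / 2).
Proof.
rewrite /phi normal_pdfE ?oner_neq0// /normal_fun subr0 expr1n; congr (_ * expR _).
Qed.

Lemma peak_gt0 (R : realType) : 0 < normal_peak (1 : R).
Proof. by apply: normal_peak_gt0; exact: oner_neq0. Qed.

Lemma phi_gt0 (R : realType) (t : R) : 0 < phi t.
Proof. by rewrite phiE mulr_gt0 ?expR_gt0// peak_gt0. Qed.

Lemma has_deriv_phi (R : realType) (t : R) : has_deriv phi t (- t * phi t).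
Proof.
have -> : @phi R = fun t => normal_peak 1 * expR (- t ^+ 2 / 2).
  by apply/funext => s; exact: phiE.
apply: has_deriv_conv; first by derive.
by rewrite /=; field.
Qed.

Lemma continuous_phi (R : realType) : continuous (@phi R).
Proof. by move=> t; exact: has_deriv_continuous (has_deriv_phi t). Qed.

Lemma integrable_phi (R : realType) (A : set R) : measurable A ->
  lebesgue_measure.-integrable A (EFin \o @phi R).
Proof.
move=> mA; apply: (integrableS measurableT) => //.
exact: integrable_normal_pdf.
Qed.

(** The measure of a half-line is an integral of [phi] from minus infinity, so the fundamental
    theorem of calculus on the ray up to [t + 1] applies at the interior point [t]. *)
Lemma has_deriv_Phi (R : realType) (t : R) : has_deriv Phi t (phi t).
Proof.
have tt : t < t + 1 by rewrite ltrDl.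
have ip : lebesgue_measure.-integrable `]-oo, (t + 1)] (EFin \o @phi R).
  by apply: integrable_phi; exact: measurable_itv.
have [|d e] := @continuous_FTC1 R phi -oo%O t (t + 1) tt ip _ (@continuous_phi R t).
  by rewrite ltNyr.
have E : (fun x0 : R => \int[lebesgue_measure]_(t in `]-oo, x0]) phi t) = @Phi R.
  by apply/funext => z; rewrite /Phi /normal_prob /Rintegral.
rewrite -E; apply: DeriveDef; first exact: d.
by rewrite -derive1E.
Qed.

Lemma Phi_ge0 (R : realType) (t : R) : 0 <= Phi t.
Proof. by rewrite /Phi fine_ge0// measure_ge0. Qed.

Lemma Phi_le1 (R : realType) (t : R) : Phi t <= 1.
Proof.
rewrite /Phi -[leRHS]/(fine 1%E) fine_le ?fin_num_measure//.
exact: probability_le1.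
Qed.

Lemma Phi_incr (R : realType) (a b : R) : a < b -> Phi a < Phi b.
Proof.
move=> ab; have [|c _ E] := @mean_value R Phi phi a b (ltW ab).
  by move=> t _; exact: has_deriv_Phi.
by rewrite -subr_gt0 E mulr_gt0 ?phi_gt0// subr_gt0.
Qed.

(** The normal law is the law of the identity random variable, so the limits known for every
    cumulative distribution function apply. Standard deviation 2 will be used for a dominating
    function. *)
Lemma cvg_normal_cdf (R : realType) (m s : R) :
  fine (normal_prob m s `]-oo, t]) @[t --> -oo] --> (0 : R) /\
  fine (normal_prob m s `]-oo, t]) @[t --> +oo] --> (1 : R).
Proof.
pose P := [the probability (measurableTypeR R) R of normal_prob m s].
have idm : (@idfun R : measurableTypeR R -> R)
    \in (@mfun _ _ (measurableTypeR R) R : pred _).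
  by rewrite inE; exact: measurable_id.
pose X : {RV P >-> R} := mfun_Sub idm.
split.
  by have /fine_cvg := @cvg_cdfNy0 _ (measurableTypeR R) R P X; apply.
by have /fine_cvg := @cvg_cdfy1 _ (measurableTypeR R) R P X; apply.
Qed.

Lemma Phibar_gt0 (R : realType) (t : R) : 0 < Phibar t.
Proof.
rewrite /Phibar subr_gt0 (lt_le_trans _ (Phi_le1 (t + 1)))//.
by apply: Phi_incr; rewrite ltrDl.
Qed.

Lemma has_deriv_Phibar (R : realType) (t : R) : has_deriv Phibar t (- phi t).
Proof.
apply: has_deriv_conv.
  by apply: has_deriv_add; [exact: has_deriv_const | exact/has_deriv_opp/has_deriv_Phi].
by rewrite add0r.
Qed.

Lemma cvg_Phibar_y (R : realType) : Phibar t @[t --> +oo] --> (0 : R).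
Proof.
rewrite -(subrr 1); apply: cvgB; first exact: cvg_cst.
exact: (cvg_normal_cdf 0 1).2.
Qed.

(** * Bounds on the Mills ratio *)

(** A negative value at [t] would persist to the right, since [f] decreases, and contradict the
    lower bound [- h s], which tends to 0. The limit of [f] itself never has to be computed. *)
Lemma ge0_of_decreasing (R : realType) (f df h : R -> R) (t : R) :
  (forall s, t <= s -> has_deriv f s (df s)) ->
  (forall s, t <= s -> df s <= 0) ->
  h s @[s --> +oo] --> (0 : R) ->
  (forall s, t <= s -> 1 <= s -> - h s <= f s) ->
  0 <= f t.
Proof.
move=> hf hdf h0 hh; rewrite leNgt; apply/negP => ft0.
have nft0 : 0 < - f t by rewrite oppr_gt0.
have /cvgrPdist_lt /(_ _ nft0) h0' := h0.
near +oo_R => s.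
have ts : t <= s by near: s; apply: nbhs_pinfty_ge; exact: num_real.
have s1 : 1 <= s by near: s; apply: nbhs_pinfty_ge; exact: num_real.
have hs : `|0 - h s| < - f t by near: s.
have [|c /andP[tc cs] E] := @mean_value R f df t s ts.
  by move=> r /andP[tr _]; exact: hf.
have : f s - f t <= 0 by rewrite E mulr_le0_ge0 ?subr_ge0// hdf.
have := hh s ts s1; move: hs; rewrite sub0r normrN => hs.
have := ler_norm (h s); lra.
Unshelve. all: by end_near. Qed.

Lemma phi_le_peak (R : realType) (t : R) : phi t <= normal_peak 1.
Proof. exact/normal_pdf_ub/oner_neq0. Qed.

(* The partial sums of the asymptotic series of the Mills ratio bracket it:
   the derivative of [phi t] times such a sum differs from [- phi t] by a
   single term of constant sign. *)
Lemma Phibar_upper (R : realType) (t : R) : 0 < t ->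
  Phibar t <= phi t * (t^-1 - t^-1 ^+ 3 + 3 * t^-1 ^+ 5).
Proof.
move=> t0; rewrite -subr_ge0.
pose f (s : R) := phi s * (s^-1 + - s^-1 ^+ 3 + 3 * s^-1 ^+ 5) + - Phibar s.
pose df (s : R) := - 15 * s^-1 ^+ 6 * phi s.
apply: (@ge0_of_decreasing R f df Phibar t).
- move=> s ts; have s0 : s != 0 by rewrite gt_eqF// (lt_le_trans t0).
  apply: has_deriv_conv.
    apply: has_deriv_add; last exact/has_deriv_opp/has_deriv_Phibar.
    apply: has_deriv_mul; first exact: has_deriv_phi.
    by derive.
  by rewrite /df /=; field.
- move=> s ts; have := mulr_ge0 (exprn_even_ge0 (n := 6) s^-1 isT) (ltW (phi_gt0 s)).
  by rewrite /df; lra.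
- exact: cvg_Phibar_y.
- move=> s ts s1; rewrite /f lerDr mulr_ge0 ?(ltW (phi_gt0 _))//.
  have s0 : 0 < s by rewrite (lt_le_trans ltr01).
  have i0 : 0 < s^-1 by rewrite invr_gt0.
  have i1 : s^-1 <= 1 by rewrite invf_le1.
  have h5 : 0 <= s^-1 ^+ 5 by rewrite exprn_ge0// ltW.
  have h3 : s^-1 ^+ 3 <= s^-1 ^+ 1 by rewrite ler_wiXn2l ?(ltW i0).
  by move: h3; rewrite expr1; lra.
Qed.

Lemma Phibar_lower (R : realType) (t : R) : 0 < t ->
  phi t * (t^-1 - t^-1 ^+ 3 + 3 * t^-1 ^+ 5 - 15 * t^-1 ^+ 7) <= Phibar t.
Proof.
move=> t0; rewrite -subr_ge0.
pose f (s : R) :=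
  Phibar s + - (phi s * (s^-1 + - s^-1 ^+ 3 + 3 * s^-1 ^+ 5 + - (15 * s^-1 ^+ 7))).
pose df (s : R) := - 105 * s^-1 ^+ 8 * phi s.
(* For s >= 1 the bracket is at most s^-1 + 3 s^-5 <= 4 s^-1, and [phi] is at most its peak. *)
apply: (@ge0_of_decreasing R f df (fun s => normal_peak 1 * 4 * s^-1) t).
- move=> s ts; have s0 : s != 0 by rewrite gt_eqF// (lt_le_trans t0).
  apply: has_deriv_conv.
    apply: has_deriv_add; first exact: has_deriv_Phibar.
    apply/has_deriv_opp/has_deriv_mul; first exact: has_deriv_phi.
    by derive.
  by rewrite /df /=; field.
- move=> s ts; have := mulr_ge0 (exprn_even_ge0 (n := 8) s^-1 isT) (ltW (phi_gt0 s)).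
  by rewrite /df; lra.
- rewrite -(mulr0 (normal_peak 1 * 4)); apply: cvgM; first exact: cvg_cst.
  by apply/gtr0_cvgV0; [exact: nbhs_pinfty_gt|exact: cvg_id].
- move=> s ts s1; rewrite /f.
  have s0 : 0 < s by rewrite (lt_le_trans ltr01).
  have i0 : 0 < s^-1 by rewrite invr_gt0.
  have i1 : s^-1 <= 1 by rewrite invf_le1.
  have P0 := Phibar_gt0 s.
  apply: (@le_trans _ _ (- (phi s * (4 * s^-1)))).
    rewrite lerN2 -mulrA ler_wpM2r ?phi_le_peak// mulr_ge0// ltW//.
  have : phi s * (s^-1 + - s^-1 ^+ 3 + 3 * s^-1 ^+ 5 + - (15 * s^-1 ^+ 7)) <= phi s * (4 * s^-1).
    rewrite ler_wpM2l ?(ltW (phi_gt0 _))//.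
    have h k : 0 <= s^-1 ^+ k by rewrite exprn_ge0// ltW.
    have h3 := h 3; have h7 := h 7.
    have h5 : s^-1 ^+ 5 <= s^-1.
      by rewrite -[leRHS]expr1; rewrite ler_wiXn2l ?(ltW i0).
    lra.
  by move: P0; lra.
Qed.

(** * The bivariate distribution function as a single integral *)

(** The Radon-Nikodym derivative of the normal law and [normal_pdf] have the same integral over
    every measurable set, hence agree almost everywhere. *)
Lemma integral_normal_prob (R : realType) (m s : R) (f : R -> \bar R) (U : set R) :
  measurable U -> (normal_prob m s).-integrable U f ->
  (\int[normal_prob m s]_(x in U) f x =
   \int[lebesgue_measure]_(x in U) (f x * (normal_pdf m s x)%:E))%E.
Proof.
move=> mU intf; have mf := measurable_int _ intf.
rewrite -(Radon_Nikodym_change_of_variables (normal_prob_dominates m s))//=.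
apply: ae_eq_integral => //.
- apply: emeasurable_funM => //; apply: (measurable_int lebesgue_measure).
  apply: (integrableS _ _ (@subsetT _ _)) => //=.
  by apply: Radon_Nikodym_integrable; exact: normal_prob_dominates.
- apply: emeasurable_funM => //=; apply/measurable_EFinP.
  by apply/measurable_funTS; exact: measurable_normal_pdf.
- apply: ae_eqe_mul2l => /=.
  rewrite Radon_NikodymE//=; first exact: normal_prob_dominates.
  move=> ndom; case: cid => /= h [h1 h2 h3].
  apply: integral_ae_eq => //=.
  + exact: integrableS h2.
  + by apply/measurable_EFinP/measurable_funTS; exact: measurable_normal_pdf.
  + by move=> E _ mE; rewrite -h3.
Qed.

Lemma measurable_continuous (R : realType) (f : R -> R) (A : set R) :
  continuous f -> measurable_fun A f.
Proof. by move=> cf; apply: measurable_funTS; exact: continuous_measurable_fun. Qed.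

Lemma continuous_Phi (R : realType) : continuous (@Phi R).
Proof. by move=> t; exact: has_deriv_continuous (has_deriv_Phi t). Qed.

Lemma continuous_affine_quot (R : realType) (v r sg : R) :
  continuous (fun t => (v - r * t) / sg).
Proof.
move=> t; apply: (@has_deriv_continuous _ _ _ (- r / sg)).
apply: has_deriv_conv; first by derive.
by rewrite /=; ring.
Qed.

Lemma continuous_Phi_affine (R : realType) (v r sg : R) :
  continuous (fun t => Phi ((v - r * t) / sg)).
Proof.
move=> t; apply: (@continuous_comp _ _ _ (fun t => (v - r * t) / sg) Phi).
  exact: continuous_affine_quot.
exact: continuous_Phi.
Qed.

Lemma normal_cdfE (R : realType) (t : R) :
  normal_prob (0 : R) 1 `]-oo, t] = (Phi t)%:E.
Proof. by rewrite /Phi fineK// fin_num_measure. Qed.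

(** The product measure integrates the measures of sections: the section at t is empty for t > u and
    otherwise a half-line ending at (v - r t) / sqrt(1 - r^2). The open range of [r] keeps the
    divisor positive. *)
Lemma bigauss_cdfE (R : realType) (r u v : R) : -1 < r < 1 ->
  bigauss_cdf r u v =
  \int[lebesgue_measure]_(t in `]-oo, u])
    (Phi ((v - r * t) / Num.sqrt (1 - r ^+ 2)) * phi t).
Proof.
move=> /andP[r1 r2]; have sg0 : 0 < Num.sqrt (1 - r ^+ 2).
  by rewrite sqrtr_gt0; nra.
set sg := Num.sqrt _ in sg0 *.
rewrite /bigauss_cdf /bigauss /pushforward /product_measure1.
pose F t := Phi ((v - r * t) / sg).
have F01 t : 0 <= F t <= 1 by rewrite /F Phi_ge0 Phi_le1.
rewrite /Rintegral; congr fine.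
pose I : set R := `]-oo, u]%classic.
transitivity (\int[normal_prob (0 : R) 1]_(t in I) (F t)%:E)%E.
  rewrite [RHS]integral_mkcond; apply: eq_integral => t _ /=.
  rewrite patchE; case: ifPn => tI.
    rewrite /F -normal_cdfE; congr normal_prob.
    rewrite /I inE/= in_itv/= in tI.
    apply/seteqP; split => z; rewrite /xsection/= inE/= !in_itv/= ler_pdivlMr//.
      by move=> [_]; rewrite lerBrDl (mulrC z).
    by rewrite lerBrDl (mulrC z).
  rewrite (_ : xsection _ _ = set0) ?measure0//.
  apply/seteqP; split => z //; rewrite /xsection/= inE/= => -[h _].
  by move/negP: tI; apply; rewrite inE.
have mF : measurable_fun I F by apply: measurable_continuous; exact: continuous_Phi_affine.
have mI : measurable I by exact: measurable_itv.
rewrite integral_normal_prob//.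
apply: (@le_integrable _ _ _ (normal_prob (0 : R) 1) I _ _ (EFin \o cst 1)) => //.
- exact/measurable_EFinP.
- move=> t _; rewrite /= lee_fin normr1 ger0_norm; by case/andP: (F01 t).
- exact: (@finite_measure_integrable_cst _ _ _ (normal_prob 0 1) I 1 mI).
Qed.

(** * Plackett's identity *)

Lemma phi_le_inv (R : realType) (t : R) : t < 0 -> phi t <= normal_peak 1 * (- t)^-1.
Proof.
move=> t0; have nt0 : 0 < - t by rewrite oppr_gt0.
rewrite phiE ler_pM2l ?peak_gt0// mulNr expRN lef_pV2 ?posrE ?expR_gt0//.
apply: le_trans (expR_ge1Dx _); nra.
Qed.

Lemma cvg_phi_Ny (R : realType) : phi t @[t --> -oo] --> (0 : R).
Proof.
apply: (@squeeze_cvgr _ _ _ _ (cst 0) (fun t => normal_peak 1 * (- t)^-1)).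
- near=> t; have t0 : t < 0 by near: t; apply: nbhs_ninfty_lt; exact: num_real.
  by rewrite /= ltW ?phi_gt0//= phi_le_inv.
- exact: cvg_cst.
- rewrite -(mulr0 (normal_peak 1)); apply: cvgM; first exact: cvg_cst.
  apply/gtr0_cvgV0.
    by near=> t; rewrite oppr_gt0; near: t; apply: nbhs_ninfty_lt; exact: num_real.
  exact/cvgNry/cvg_id.
Unshelve. all: by end_near. Qed.

(** The integral up to s and [F] have the same derivative and both vanish at minus infinity; the
    majorant [g] makes the integral converge and tend to 0. *)
Lemma Rintegral_Ny_derive (R : realType) (F f g : R -> R) (u : R) :
  (forall t, has_deriv F t (f t)) ->
  continuous f ->
  (forall t, `|f t| <= g t) ->
  lebesgue_measure.-integrable [set: R] (EFin \o g) ->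
  F t @[t --> -oo] --> (0 : R) ->
  (\int[lebesgue_measure]_(t in `]-oo, s]) g t) @[s --> -oo] --> (0 : R) ->
  \int[lebesgue_measure]_(t in `]-oo, u]) f t = F u.
Proof.
move=> dF cf fg ig F0 g0.
have mI (s : R) : measurable (`]-oo, s]%classic : set R) by exact: measurable_itv.
have ig' (s : R) : lebesgue_measure.-integrable `]-oo, s] (EFin \o g).
  exact: (integrableS measurableT).
have if' (s : R) : lebesgue_measure.-integrable `]-oo, s] (EFin \o f).
  apply: le_integrable (ig' s) => //.
    by apply/measurable_EFinP; exact: measurable_continuous.
  by move=> t _ /=; rewrite lee_fin (le_trans (fg t))// ler_norm.
pose N s := \int[lebesgue_measure]_(t in `]-oo, s]) f t.
have dN s : has_deriv N s (f s).
  have ss : s < s + 1 by rewrite ltrDl.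
  have [|d e] := @continuous_FTC1 R f -oo%O s (s + 1) ss (if' _) _ (cf s).
    by rewrite ltNyr.
  by apply: DeriveDef; [exact: d|rewrite -derive1E].
have N0 : N s @[s --> -oo] --> (0 : R).
  apply: norm_cvg0; apply: (@squeeze_cvgr _ _ _ _ (cst 0) _ _ _ _ _ g0).
    near=> s; rewrite normr_ge0/= (le_trans (le_normr_Rintegral _ _))//.
    apply: le_Rintegral => //.
    exact: integrable_norm.
  exact: cvg_cst.
have E0 : (N s + - F s) @[s --> -oo] --> (0 : R).
  by rewrite -[X in _ --> X](subrr 0); apply: cvgB.
have Ec s : N s + - F s = N u + - F u.
  have h a b : a <= b -> N b + - F b = N a + - F a.
    move=> ab.
    have [|c _ /eqP] := @mean_value R (fun s => N s + - F s) (fun s => f s + - f s) a b ab.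
      by move=> t _; apply: has_deriv_add; [exact: dN|exact/has_deriv_opp/dF].
    by rewrite subrr mul0r subr_eq0 => /eqP.
  by have [/h|/ltW/h] := leP u s.
apply/eqP; rewrite -subr_eq0; apply/eqP.
have EE : (fun s => N s + - F s) = cst (N u + - F u) by apply/funext.
move: E0; rewrite EE => /(cvg_unique _ (@cvg_cst _ _ _ _ _)); apply.
exact: norm_hausdorff.
Unshelve. all: by end_near. Qed.

Lemma has_deriv_sqrt (R : realType) (f : R -> R) (x a : R) : 0 < f x ->
  has_deriv f x a ->
  has_deriv (fun t => Num.sqrt (f t)) x (a / (2 * Num.sqrt (f x))).
Proof.
move=> fx0 fa; apply: has_deriv_conv.
  exact: (has_deriv_compose (is_derive1_sqrt fx0) fa).
by rewrite mulrC.
Qed.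

Lemma has_deriv_phi_comp (R : realType) (f : R -> R) (x a : R) :
  has_deriv f x a -> has_deriv (fun t => phi (f t)) x (- f x * phi (f x) * a).
Proof. by move=> fa; exact: (has_deriv_compose (has_deriv_phi _) fa). Qed.

Lemma has_deriv_Phi_comp (R : realType) (f : R -> R) (x a : R) :
  has_deriv f x a -> has_deriv (fun t => Phi (f t)) x (phi (f x) * a).
Proof. by move=> fa; exact: (has_deriv_compose (has_deriv_Phi _) fa). Qed.

(* [t -> phi t * |t|] is dominated by a multiple of the N(0,4) density, whose
   lower tail the library already controls. *)
Lemma phi_moment_le (R : realType) (a t : R) : 0 <= a ->
  phi t * (a + `|t|)
    <= (a + 1) * normal_peak 1 / normal_peak 2 * normal_pdf 0 2 t.
Proof.
move=> a0; have p1 := peak_gt0 R.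
have p2 : 0 < normal_peak (2 : R) by apply: normal_peak_gt0; rewrite pnatr_eq0.
rewrite phiE normal_pdfE ?pnatr_eq0// /normal_fun subr0.
rewrite (_ : _ / _ * (_ * _) = normal_peak 1 * ((a + 1) * expR (- t ^+ 2 / (2 ^+ 2 *+ 2)))); last first.
  by field; rewrite gt_eqF.
rewrite -mulrA ler_pM2l//.
set e := expR (- t ^+ 2 / (2 ^+ 2 *+ 2)).
have e0 : 0 < e by exact: expR_gt0.
(* 3/8 = 1/2 - 1/8 is the part of the exponent left once the N(0,4) density has taken its t^2 /
   8. *)
have -> : expR (- t ^+ 2 / 2) = e * expR (- (3 / 8 * t ^+ 2)).
  by rewrite -expRD; congr expR; field.
rewrite -mulrA [leRHS]mulrC ler_pM2l// expRN ler_pdivrMl ?expR_gt0//.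
have h := expR_ge1Dx (3 / 8 * t ^+ 2).
have t2 : t ^+ 2 = `|t| ^+ 2 by rewrite real_normK ?num_real.
have t0 : 0 <= `|t| by [].
move: h; rewrite {}t2; move: `|t| t0 => w w0 h.
have a1 : 0 <= a + 1 by lra.
apply: le_trans (ler_wpM2r a1 h).
(* 1 - w + 3/8 w^2 is smallest at w = 4/3, where it equals 1/3. *)
have := sqr_ge0 (w - 4 / 3); have := mulr_ge0 a0 (sqr_ge0 w); nra.
Qed.

Lemma sqrt_1Bsqr_gt0 (R : realType) (r : R) : -1 < r < 1 -> 0 < Num.sqrt (1 - r ^+ 2).
Proof. by move=> /andP[r1 r2]; rewrite sqrtr_gt0; nra. Qed.

Lemma sqr_sqrt_1Bsqr (R : realType) (r : R) : -1 < r < 1 ->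
  Num.sqrt (1 - r ^+ 2) ^+ 2 = 1 - r ^+ 2.
Proof. by move=> /sqrt_1Bsqr_gt0; rewrite sqrtr_gt0 => /ltW /sqr_sqrtr. Qed.

Lemma has_deriv_gauss_slope (R : realType) (v r t : R) : -1 < r < 1 ->
  has_deriv (fun r => (v - r * t) / Num.sqrt (1 - r ^+ 2)) r
    ((r * v - t) / Num.sqrt (1 - r ^+ 2) ^+ 3).
Proof.
move=> r1; have sg0 := sqrt_1Bsqr_gt0 r1; have sg2 := sqr_sqrt_1Bsqr r1.
apply: has_deriv_conv.
  apply: has_deriv_mul; first by derive.
  apply: has_deriv_inv; first by rewrite gt_eqF.
  by apply: has_deriv_sqrt; [rewrite -sqrtr_gt0|derive].
move: sg0 sg2; set sg := Num.sqrt _ => sg0 sg2.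
have sgn : sg != 0 by rewrite gt_eqF.
rewrite /=; apply: (mulIf (expf_neq0 3 sgn)); rewrite mulfVK ?expf_neq0//.
transitivity (- t * sg ^+ 2 + r * (v - r * t)); first by field.
by rewrite sg2; ring.
Qed.

(** This derivative in t equals the derivative in r of the integrand of [bigauss_cdfE], which is why
    the integral over t <= u collapses to the bivariate density at (u, v). *)
Lemma has_deriv_gauss_density (R : realType) (v r t : R) : -1 < r < 1 ->
  has_deriv
    (fun t => phi t * phi ((v - r * t) / Num.sqrt (1 - r ^+ 2)) / Num.sqrt (1 - r ^+ 2)) t
    (phi ((v - r * t) / Num.sqrt (1 - r ^+ 2))
     * ((r * v - t) / Num.sqrt (1 - r ^+ 2) ^+ 3) * phi t).
Proof.
move=> r1; have sg0 := sqrt_1Bsqr_gt0 r1; have sg2 := sqr_sqrt_1Bsqr r1.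
move: sg0 sg2; set sg := Num.sqrt _ => sg0 sg2.
have sgn : sg != 0 by rewrite gt_eqF.
apply: has_deriv_conv.
  apply: has_deriv_mul; last exact: has_deriv_const.
  apply: has_deriv_mul; first exact: has_deriv_phi.
  by apply: has_deriv_phi_comp; derive.
rewrite /=; apply: (mulIf (expf_neq0 3 sgn)).
transitivity (phi ((v - r * t) / sg) * phi t * (- t * sg ^+ 2 + r * (v - r * t))).
  by field.
by rewrite sg2; field.
Qed.

(** Differentiation under the integral sign in [bigauss_cdfE]; [has_deriv_gauss_density] then
    evaluates the integral by its boundary term. *)
Theorem plackett (R : realType) (u v r : R) : -1 < r < 1 ->
  has_deriv (fun r => bigauss_cdf r u v) r
    (phi u * phi ((v - r * u) / Num.sqrt (1 - r ^+ 2)) / Num.sqrt (1 - r ^+ 2)).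
Proof.
move=> r11; have /andP[r1 r2] := r11.
(* [k] lies strictly between |r| and 1, so on ]-k, k[ the conditional standard deviation stays above
   a positive constant. *)
pose k := (1 + `|r|) / 2.
have kr : `|r| < 1 by rewrite ltr_norml r1 r2.
have k1 : 0 <= k < 1 by have := normr_ge0 r; rewrite /k; lra.
have rk : `]- k, k[%classic r.
  by rewrite /= in_itv/= -ltr_norml /k; lra.
have kI x : `]- k, k[%classic x -> -1 < x < 1 /\ Num.sqrt (1 - k ^+ 2) <= Num.sqrt (1 - x ^+ 2).
  rewrite /= in_itv/= => /andP[xk kx]; split; first by lra.
  by rewrite ler_sqrt; nra.
pose f x t := Phi ((v - x * t) / Num.sqrt (1 - x ^+ 2)) * phi t.
pose f' x t := phi ((v - x * t) / Num.sqrt (1 - x ^+ 2))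
  * ((x * v - t) / Num.sqrt (1 - x ^+ 2) ^+ 3) * phi t.
have df x t : -1 < x < 1 -> has_deriv (f ^~ t) x (f' x t).
  move=> x1; apply: has_deriv_conv.
    apply: has_deriv_mul; last exact: has_deriv_const.
    by apply: has_deriv_Phi_comp; exact: has_deriv_gauss_slope.
  by rewrite mulr0 addr0.
(* Bounds for the factors of [f']: the peak of [phi], the cube of the smallest standard deviation,
   and [phi_moment_le] with a = |v|, since |x v - t| <= |v| + |t|. *)
pose C := normal_peak 1 / Num.sqrt (1 - k ^+ 2) ^+ 3
  * ((`|v| + 1) * normal_peak 1 / normal_peak 2).
pose G t := C * normal_pdf 0 2 t.
have p2 : 0 < normal_peak (2 : R) by apply: normal_peak_gt0; rewrite pnatr_eq0.
have p1 := peak_gt0 R.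
have sk0 : 0 < Num.sqrt (1 - k ^+ 2) by rewrite sqrtr_gt0; nra.
have C0 : 0 <= C by rewrite /C !mulr_ge0 ?invr_ge0 ?exprn_ge0// ?ltW// addr_ge0.
have G0 t : 0 <= G t by rewrite mulr_ge0// normal_pdf_ge0.
have f'G x t : `]- k, k[%classic x -> `|f' x t| <= G t.
  move=> /kI[x1 sx]; have sg0 := sqrt_1Bsqr_gt0 x1.
  rewrite /f' /G /C; move: sg0 sx; set sg := Num.sqrt (1 - x ^+ 2); set s0 := Num.sqrt (1 - k ^+ 2) in sk0 *.
  move=> sg0 sx.
  rewrite !normrM (gtr0_norm (phi_gt0 _)) (gtr0_norm (phi_gt0 t)) normfV.
  rewrite [`|sg ^+ 3|]gtr0_norm ?exprn_gt0// -[leRHS]mulrA.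
  rewrite (_ : _ * _ * phi t =
    (phi ((v - x * t) / sg) / sg ^+ 3) * (phi t * `|x * v - t|)); last by ring.
  apply: ler_pM.
  - by rewrite mulr_ge0 ?invr_ge0 ?exprn_ge0 ?(ltW (phi_gt0 _))// ltW.
  - by rewrite mulr_ge0 ?(ltW (phi_gt0 _)).
  - apply: ler_pM; rewrite ?invr_ge0 ?exprn_ge0 ?(ltW (phi_gt0 _)) ?(ltW sg0)//.
      exact: phi_le_peak.
    rewrite lef_pV2 ?posrE ?exprn_gt0//; apply: lerXn2r => //; rewrite ?nnegrE ltW//.
  - apply: le_trans (phi_moment_le t (normr_ge0 v)).
    rewrite ler_wpM2l ?(ltW (phi_gt0 _))// (le_trans (ler_normB _ _))// lerD2r.
    rewrite normrM ler_piMl// ler_norml; lra.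
have iG : lebesgue_measure.-integrable [set: R] (EFin \o G).
  exact: (integrableZl measurableT C (integrable_normal_pdf 0 2)).
have FE x : `]- k, k[%classic x ->
    bigauss_cdf x u v = \int[lebesgue_measure]_(t in `]-oo, u]) f x t.
  by move=> /kI[x1 _]; rewrite bigauss_cdfE.
have mI (s : R) : measurable (`]-oo, s]%classic : set (measurableTypeR R)).
  exact: measurable_itv.
have intf x : `]- k, k[%classic x -> lebesgue_measure.-integrable `]-oo, u] (EFin \o f x).
  move=> _; apply: le_integrable (integrable_phi (mI u)) => //.
    apply/measurable_EFinP/measurable_funM; apply: measurable_continuous.
      exact: continuous_Phi_affine.
    exact: continuous_phi.
  move=> t _ /=; rewrite lee_fin normrM ler_piMl//.
  by rewrite ger0_norm ?Phi_ge0 ?Phi_le1.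
have derf x t : `]- k, k[%classic x -> `]-oo, u]%classic t -> derivable (f ^~ t) x 1.
  by move=> /kI[x1 _] _; have [] := df x t x1.
have f'E x t : `]- k, k[%classic x -> partial1of2 f x t = f' x t.
  by move=> /kI[x1 _]; rewrite partial1of2E; have [_] := df x t x1.
have iGu : lebesgue_measure.-integrable `]-oo, u] (EFin \o G).
  exact: integrableS iG.
have bG x t : `]- k, k[%classic x -> `]-oo, u]%classic t -> `|partial1of2 f x t| <= G t.
  by move=> xk _; rewrite f'E//; exact: f'G.
have D1 := derivable_under_integral (mI u) rk intf derf G0 iGu bG.
have D2 := differentiation_under_integral (mI u) rk intf derf G0 iGu bG.
have rknear : \near r, bigauss_cdf r u v = \int[lebesgue_measure]_(t in `]-oo, u]) f r t.
  near=> x; apply: FE; near: x.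
  exact: near_in_itvoo.
have V : \int[lebesgue_measure]_(t in `]-oo, u]) f' r t =
    phi u * phi ((v - r * u) / Num.sqrt (1 - r ^+ 2)) / Num.sqrt (1 - r ^+ 2).
  apply: (@Rintegral_Ny_derive R (fun t => phi t * phi ((v - r * t) / Num.sqrt (1 - r ^+ 2))
    / Num.sqrt (1 - r ^+ 2)) (f' r) G) => //.
  - by move=> t; exact: has_deriv_gauss_density.
  - move=> t; apply: has_deriv_continuous; rewrite /f'; apply: has_deriv_mul.
      by apply: has_deriv_mul; [apply: has_deriv_phi_comp; derive|derive].
    exact: has_deriv_phi.
  - by move=> t; exact: f'G.
  - have sg0 := sqrt_1Bsqr_gt0 r11.
    apply: (@squeeze_cvgr _ _ _ _ (cst 0)
      (fun t => phi t * (normal_peak 1 / Num.sqrt (1 - r ^+ 2)))).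
    + apply: nearW => t; rewrite -mulrA; apply/andP; split.
        by rewrite mulr_ge0 ?divr_ge0 ?(ltW (phi_gt0 _)) ?(ltW sg0).
      by rewrite ler_pM2l ?phi_gt0// ler_pM2r ?invr_gt0// phi_le_peak.
    + exact: cvg_cst.
    + rewrite -[X in _ --> X](mul0r (normal_peak 1 / Num.sqrt (1 - r ^+ 2))).
      by apply: cvgM; [exact: cvg_phi_Ny|exact: cvg_cst].
  - rewrite (_ : (fun s => _) = fun s => C * fine (normal_prob 0 2 `]-oo, s])).
      rewrite -[X in _ --> X](mulr0 C).
      by apply: cvgM; [exact: cvg_cst|exact: (cvg_normal_cdf 0 2).1].
    apply/funext => s; rewrite /G RintegralZl//.
    by apply: integrableS (integrable_normal_pdf 0 2).
have D : has_deriv (fun r => \int[lebesgue_measure]_(t in `]-oo, u]) f r t) r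
    (\int[lebesgue_measure]_(t in `]-oo, u]) f' r t).
  apply: DeriveDef; first exact: D1.
  rewrite -derive1E D2; apply: eq_Rintegral => t _.
  by rewrite -f'E.
rewrite -V; apply: near_eq_is_derive D.
by apply: filterS rknear => x ->.
Unshelve. all: by end_near. Qed.

Lemma bigauss_cdf0 (R : realType) (u v : R) : bigauss_cdf 0 u v = Phi u * Phi v.
Proof.
rewrite bigauss_cdfE ?ltrN10 ?ltr01// expr0n/= subr0 sqrtr1.
under eq_Rintegral do rewrite mul0r subr0 divr1.
rewrite RintegralZl//; last exact: integrable_phi (measurable_itv _).
by rewrite mulrC.
Qed.

(** * The path in m and the derivative along it *)

(** The derivative in m of - ln H_m(x, y), the latter being [tail_term0] below. *)
Definition tail_density (R : realType) (x y m : R) : R :=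
  2 * expR (- x) * phi (m + (y - x) / (2 * m)).

Definition density_rate (R : realType) (x y m : R) : R := (m ^+ 2 + (x + y) / 2) ^+ 2 / 2.

(* The correlation is parametrized by m through rho = 1 - 2 m^2 / b^2, so that
   m = lambda_n gives rho = rho_n. *)
Definition scaled_tail (R : realType) (b x y m : R) : R :=
  b / phi b * (1 - bigauss_cdf (1 - 2 * m ^+ 2 / b ^+ 2) (b + x / b) (b + y / b)).

(** Plackett's identity and the chain rule with dr/dm = - 4 m / b^2; the condition m < b says that r
    > -1. *)
Lemma has_deriv_scaled_tail (R : realType) (b x y m : R) : 0 < m -> m < b ->
  has_deriv (scaled_tail b x y) m
    (tail_density x y m * (Num.sqrt (1 - m ^+ 2 / b ^+ 2))^-1
     * expR (- (density_rate x y m / b ^+ 2 / (1 - m ^+ 2 / b ^+ 2)))).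
Proof.
move=> m0 mb; have b0 : 0 < b by lra.
set w := m ^+ 2 / b ^+ 2.
have w0 : 0 < w by rewrite divr_gt0 ?exprn_gt0.
have w1 : w < 1.
  by rewrite ltr_pdivrMr ?exprn_gt0// mul1r ltr_pXn2r ?nnegrE ?ltW.
have rE : 1 - 2 * m ^+ 2 / b ^+ 2 = 1 - 2 * w by rewrite /w mulrA.
have r11 : -1 < 1 - 2 * m ^+ 2 / b ^+ 2 < 1 by rewrite rE; lra.
have q0 : 0 < Num.sqrt (1 - w) by rewrite sqrtr_gt0; lra.
have q2 : Num.sqrt (1 - w) ^+ 2 = 1 - w by rewrite sqr_sqrtr; lra.
(* With r = 1 - 2 w one has 1 - r^2 = 4 w (1 - w). *)
have sE : Num.sqrt (1 - (1 - 2 * m ^+ 2 / b ^+ 2) ^+ 2) = 2 * m / b * Num.sqrt (1 - w).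
  rewrite (_ : 1 - _ ^+ 2 = (2 * m / b * Num.sqrt (1 - w)) ^+ 2).
    by rewrite sqrtr_sqr gtr0_norm// !mulr_gt0 ?invr_gt0.
  by rewrite exprMn q2 rE /w; field; rewrite gt_eqF.
apply: has_deriv_conv.
  apply: has_deriv_mul; first exact: has_deriv_const.
  apply: has_deriv_add; first exact: has_deriv_const.
  apply: has_deriv_opp.
  apply: (@has_deriv_compose _ (fun r => bigauss_cdf r (b + x / b) (b + y / b))
    (fun m => 1 - 2 * m ^+ 2 / b ^+ 2)).
    exact: plackett.
  by derive.
rewrite sE /=; set q := Num.sqrt (1 - w) in q0 q2 *.
rewrite /tail_density !phiE; set p := normal_peak 1.
have p0 : 0 < p by exact: peak_gt0.
set u := b + x / b; set v := b + y / b; set r := 1 - 2 * m ^+ 2 / b ^+ 2.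
have bn : b != 0 by rewrite gt_eqF.
have mn : m != 0 by rewrite gt_eqF.
have qn : q != 0 by rewrite gt_eqF.
have w1n : 1 - w != 0 by rewrite gt_eqF// subr_gt0.
have dn : b ^+ 2 - m ^+ 2 != 0.
  by rewrite gt_eqF// subr_gt0 ltr_pXn2r ?nnegrE ?ltW.
(* Splitting of the quadratic form: exp(- b^2 / 2) cancels against [phi b], the next two factors
   belong to [tail_density], and the last holds the rest of the exponent. *)
have X : expR (- u ^+ 2 / 2) * expR (- ((v - r * u) / (2 * m / b * q)) ^+ 2 / 2) =
  expR (- b ^+ 2 / 2) * (expR (- x) * expR (- (m + (y - x) / (2 * m)) ^+ 2 / 2)
    * expR (- (density_rate x y m / b ^+ 2 / (1 - w)))).
  rewrite -!expRD; congr expR.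
  rewrite !expr_div_n !exprMn q2 /density_rate /w /u /v /r.
  by field; rewrite bn mn dn.
have e0 : expR (- b ^+ 2 / 2) != 0 by rewrite gt_eqF ?expR_gt0.
have pn : p != 0 by rewrite gt_eqF.
transitivity (4 * m / (b * (p * expR (- b ^+ 2 / 2))) * (p ^+ 2 / (2 * m / b * q)) *
  (expR (- u ^+ 2 / 2) * expR (- ((v - r * u) / (2 * m / b * q)) ^+ 2 / 2))).
  by field; rewrite bn mn qn e0 pn.
rewrite X; by field; rewrite bn mn qn e0 pn.
Qed.

(** With d = (y - x) / (2 m), the squares of m + d and m - d differ by 4 m d = 2 (y - x). Every
    density term can thus be written over e^-x. *)
Lemma expR_phi_sym (R : realType) (x y m : R) : m != 0 ->
  expR (- y) * phi (m + (x - y) / (2 * m)) = expR (- x) * phi (m + (y - x) / (2 * m)).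
Proof.
move=> m0; rewrite !phiE mulrCA [RHS]mulrCA -!expRD; congr (_ * expR _).
by field.
Qed.

(** * Coefficients of the expansion and their antiderivatives *)

(** With [density_coef2], the coefficients of eps and eps^2 in (1 - w)^(-1/2) exp(- eps S / (1 - w))
    at w = m^2 eps, where S is [density_rate]. *)
Definition density_coef1 (R : realType) (x y m : R) : R := m ^+ 2 / 2 - density_rate x y m.

Definition density_coef2 (R : realType) (x y m : R) : R :=
  3 / 8 * m ^+ 4 - 3 / 2 * density_rate x y m * m ^+ 2 + density_rate x y m ^+ 2 / 2.

(** The common shape of the antiderivatives. [p] and [q] are constant in m and alone survive as m
    grows; [r] is polynomial in m and is killed by [phi]. *)
Definition tail_sum (R : realType) (p q r x y m : R) : R :=
  p * expR (- x) * Phi (m + (y - x) / (2 * m))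
  + q * expR (- y) * Phi (m + (x - y) / (2 * m))
  + r * expR (- x) * phi (m + (y - x) / (2 * m)).

(** With [pol2], the coefficients of b^-2 and b^-4 in the expansion of e^z (b / phi(b)) (1 - Phi(b +
    z / b)). *)
Definition pol1 (R : realType) (z : R) : R := - (z ^+ 2 + 2 * z + 2) / 2.

Definition pol2 (R : realType) (z : R) : R :=
  (z ^+ 4 + 4 * z ^+ 3 + 12 * z ^+ 2 + 24 * z + 24) / 8.

(* [mid1] and [mid2] are the odd polynomials in m that make the derivatives of
   [tail_term1] and [tail_term2] the multiples [density_coef1] and [density_coef2]
   of [tail_density]; they are read off kappa and tau at alpha = beta = 0. *)
Definition mid1 (R : realType) (x y m : R) : R := m * (m ^+ 2 + x + y + 2).

Definition mid2 (R : realType) (x y m : R) : R :=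
  - (m ^+ 7 / 4 + m ^+ 5 / 4 + (x + y) * m ^+ 5 / 2
     + m ^+ 3 * (1 + x + y + 5 / 8 * x * y + 7 / 16 * (x ^+ 2 + y ^+ 2))
     + m * ((x ^+ 3 + y ^+ 3 + x * y ^+ 2 + x ^+ 2 * y) / 4 + x ^+ 2 + y ^+ 2
            + x * y + 2 * x + 2 * y + 4))
  - m ^+ 3 - m * (x + y + 2).

Definition tail_term0 (R : realType) (x y m : R) : R := tail_sum 1 1 0 x y m.
Definition tail_term1 (R : realType) (x y m : R) : R :=
  tail_sum (pol1 x) (pol1 y) (mid1 x y m) x y m.
Definition tail_term2 (R : realType) (x y m : R) : R :=
  tail_sum (pol2 x) (pol2 y) (mid2 x y m) x y m.

(** [expR_phi_sym] puts the derivatives of all three terms over one factor, so that matching with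
    [tail_density] becomes a rational identity in m, x and y. *)
Lemma has_deriv_tail_sum (R : realType) (p q x y m : R) (r : R -> R) (dr : R) :
  m != 0 -> has_deriv r m dr ->
  has_deriv (fun m => tail_sum p q (r m) x y m) m
    ((p * (1 - (y - x) / (2 * m ^+ 2)) + q * (1 + (y - x) / (2 * m ^+ 2)) + dr
      - r m * (m + (y - x) / (2 * m)) * (1 - (y - x) / (2 * m ^+ 2)))
     * (expR (- x) * phi (m + (y - x) / (2 * m)))).
Proof.
move=> m0 hr; have m2 : 2 * m != 0 by rewrite mulf_neq0// pnatr_eq0.
apply: has_deriv_conv.
  apply: has_deriv_add; last first.
    apply: has_deriv_mul; last by apply: has_deriv_phi_comp; derive.
    by derive.
  by apply: has_deriv_add; (apply: has_deriv_mul;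
    [exact: has_deriv_const|apply: has_deriv_Phi_comp; derive]).
rewrite /=; have := expR_phi_sym x y m0.
set E := expR (- y); set F := phi (m + (x - y) / (2 * m)) => EF.
transitivity ((p * (1 - (y - x) / (2 * m ^+ 2)) * expR (- x) * phi (m + (y - x) / (2 * m))
   + q * (1 + (y - x) / (2 * m ^+ 2)) * (E * F)
   + (dr - r m * (m + (y - x) / (2 * m)) * (1 - (y - x) / (2 * m ^+ 2)))
      * expR (- x) * phi (m + (y - x) / (2 * m)))).
  by field.
by rewrite EF; ring.
Qed.

Lemma has_deriv_tail_term0 (R : realType) (x y m : R) : m != 0 ->
  has_deriv (tail_term0 x y) m (tail_density x y m).
Proof.
move=> m0; apply: has_deriv_conv.
  exact: (has_deriv_tail_sum 1 1 x y m0 (has_deriv_const 0 m)).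
by rewrite /tail_density /=; field.
Qed.

Lemma has_deriv_tail_term1 (R : realType) (x y m : R) : m != 0 ->
  has_deriv (tail_term1 x y) m (tail_density x y m * density_coef1 x y m).
Proof.
move=> m0; apply: has_deriv_conv.
  by apply: (has_deriv_tail_sum _ _ _ _ m0); rewrite /mid1; derive.
by rewrite /tail_density /density_coef1 /density_rate /mid1 /pol1 /=; field.
Qed.

Lemma has_deriv_tail_term2 (R : realType) (x y m : R) : m != 0 ->
  has_deriv (tail_term2 x y) m (tail_density x y m * density_coef2 x y m).
Proof.
move=> m0; apply: has_deriv_conv.
  by apply: (has_deriv_tail_sum _ _ _ _ m0); rewrite /mid2; derive.
by rewrite /tail_density /density_coef2 /density_rate /mid2 /pol2 /=; field.
Qed.

(** * Uniform error of the expansion *)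

(** Two integrations of Taylor inequalities, starting from 1 - s <= e^-s. *)
Lemma expRN_bounds (R : realType) (s : R) : 0 <= s ->
  1 - s + s ^+ 2 / 2 - s ^+ 3 / 6 <= expR (- s) <= 1 - s + s ^+ 2 / 2.
Proof.
move=> s0.
have dexp (t : R) : has_deriv (fun t => expR (- t)) t (- expR (- t)).
  by apply: has_deriv_conv; [derive|rewrite mulrN1].
have up (t : R) : 0 <= t -> expR (- t) <= 1 - t + t ^+ 2 / 2.
  move=> t0.
  suff : expR (- t) - expR (- 0) <= (- t + t ^+ 2 / 2) - (- 0 + 0 ^+ 2 / 2).
    by rewrite oppr0 expR0 expr0n/=; lra.
  apply: (@le_of_derive_le R (fun t => expR (- t)) (fun t => - t + t ^+ 2 / 2)
    (fun t => - expR (- t)) (fun t => - 1 + t) 0 t t0) => r _.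
  - exact: dexp.
  - by apply: has_deriv_conv; [derive|rewrite /=; field].
  - by have := expR_ge1Dx (- r); lra.
rewrite up// andbT.
suff : (- s + s ^+ 2 / 2 - s ^+ 3 / 6) - (- 0 + 0 ^+ 2 / 2 - 0 ^+ 3 / 6)
    <= expR (- s) - expR (- 0).
  by rewrite oppr0 expR0 !expr0n/=; lra.
apply: (@le_of_derive_le R (fun t => - t + t ^+ 2 / 2 - t ^+ 3 / 6) (fun t => expR (- t))
  (fun t => - 1 + t - t ^+ 2 / 2) (fun t => - expR (- t)) 0 s s0) => r /andP[r0 _].
- by apply: has_deriv_conv; [derive|rewrite /=; field].
- exact: dexp.
- by have := up r r0; lra.
Qed.

Lemma inv_sqrt_expansion (R : realType) (w : R) : 0 <= w <= 1 / 2 ->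
  0 <= (Num.sqrt (1 - w))^-1 - (1 + w / 2 + 3 / 8 * w ^+ 2) <= w ^+ 3.
Proof.
move=> /andP[w0 w1].
have q0 : 0 < Num.sqrt (1 - w) by rewrite sqrtr_gt0; lra.
have q2 : Num.sqrt (1 - w) ^+ 2 = 1 - w by rewrite sqr_sqrtr; lra.
have p0 : 0 < (Num.sqrt (1 - w))^-1 by rewrite invr_gt0.
have p2 : (Num.sqrt (1 - w))^-1 ^+ 2 * (1 - w) = 1.
  by rewrite -[X in _ * X]q2 exprVn mulVf// expf_neq0// gt_eqF.
move: (Num.sqrt (1 - w))^-1 p0 p2 => p p0 p2.
set q := 1 + w / 2 + 3 / 8 * w ^+ 2.
have qge : 1 <= q by rewrite /q; have := sqr_ge0 w; lra.
have pge : 1 <= p by nra.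
have w3 : 0 <= w ^+ 3 by rewrite exprn_ge0.
have E : (p - q) * ((p + q) * (1 - w)) = w ^+ 3 * (5 / 8 + 15 / 64 * w + 9 / 64 * w ^+ 2).
  rewrite (_ : (p - q) * _ = p ^+ 2 * (1 - w) - q ^+ 2 * (1 - w)); last by ring.
  by rewrite p2 /q; field.
have f1 : 1 <= (p + q) * (1 - w) by nra.
have g1 : 0 <= 5 / 8 + 15 / 64 * w + 9 / 64 * w ^+ 2 <= 1.
  have := sqr_ge0 w; have : w ^+ 2 <= w by rewrite expr2; nra.
  by lra.
move: E g1; set g := 5 / 8 + _ + _; set z := (p + q) * _ in f1 *; move=> E /andP[g0 g1].
have z0 : 0 < z by lra.
have pq : 0 <= p - q by rewrite -(pmulr_lge0 _ z0) E mulr_ge0.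
rewrite pq/=; apply: le_trans (_ : (p - q) * z <= _).
  by rewrite ler_peMr.
by rewrite E ler_piMr.
Qed.

(** Three replacements: the root by its polynomial, the exponential by its quadratic polynomial,
    then 1 / (1 - w) by its expansion. They cost 1, 2 and 9 times d^3. *)
Lemma density_ratio_expansion (R : realType) (w s d : R) :
  0 <= w <= 1 / 2 -> 0 <= s -> w <= d -> s <= d ->
  `|(Num.sqrt (1 - w))^-1 * expR (- (s / (1 - w)))
    - (1 + (w / 2 - s) + (3 / 8 * w ^+ 2 - 3 / 2 * s * w + s ^+ 2 / 2))|
  <= 12 * d ^+ 3.
Proof.
move=> w01 s0 wd sd; have /andP[w0 w1] := w01.
have := inv_sqrt_expansion w01.
move: (Num.sqrt (1 - w))^-1 => p /andP[p1 p2].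
set q := 1 + w / 2 + 3 / 8 * w ^+ 2 in p1 p2.
have k0 : 0 < (1 - w)^-1 by rewrite invr_gt0; lra.
have kE : (1 - w)^-1 * (1 - w) = 1 by rewrite mulVf//; apply/eqP; lra.
move: (1 - w)^-1 k0 kE => k k0 kE.
have k1 : 1 <= k by nra.
have k2 : k <= 2 by nra.
have sk : 0 <= s * k by rewrite mulr_ge0// ltW.
have /andP[e1 e2] := expRN_bounds sk.
have e3 : 0 < expR (- (s * k)) := expR_gt0 _.
have e4 : expR (- (s * k)) <= 1 by rewrite expR_le1 oppr_le0.
move: (expR _) e1 e2 e3 e4 => e e1 e2 e3 e4.
have d0 : 0 <= d by lra.
have q1 : 1 <= q <= 3 / 2 by rewrite /q; nra.
set X := 1 - s * k + (s * k) ^+ 2 / 2 in e1 e2.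
have d3 : 0 <= d ^+ 3 by rewrite exprn_ge0.
have sw0 : 0 <= s * w by rewrite mulr_ge0.
have sd3 : s ^+ 3 <= d ^+ 3 by rewrite lerXn2r ?nnegrE.
have wd3 : w ^+ 3 <= d ^+ 3 by rewrite lerXn2r ?nnegrE.
have sww : 0 <= s * w ^+ 2 <= d ^+ 3.
  rewrite mulr_ge0 ?sqr_ge0//= [leRHS]exprS ler_pM ?sqr_ge0//.
  by rewrite lerXn2r ?nnegrE.
have ssw : 0 <= s ^+ 2 * w <= d ^+ 3.
  rewrite mulr_ge0 ?sqr_ge0//= [leRHS]exprSr ler_pM ?sqr_ge0//.
  by rewrite lerXn2r ?nnegrE.
have /andP[q1a q1b] := q1.
have A : `|(p - q) * e| <= d ^+ 3.
  rewrite ger0_norm; last by rewrite mulr_ge0// ltW.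
  by apply: le_trans wd3; apply: le_trans p2; rewrite ler_piMr.
have B : `|q * (e - X)| <= 2 * d ^+ 3.
  rewrite ler0_norm; last by rewrite mulr_ge0_le0; lra.
  (* From (s k)^3 / 6 with k <= 2; the factor q <= 3/2 then gives the constant 2. *)
  have h : 0 <= X - e <= 4 / 3 * d ^+ 3.
    apply/andP; split; first by lra.
    have k8 : k ^+ 3 <= 2 ^+ 3 by rewrite lerXn2r ?nnegrE// ltW.
    have : (s * k) ^+ 3 <= d ^+ 3 * 2 ^+ 3.
      by rewrite exprMn ler_pM ?exprn_ge0// ltW.
    by lra.
  by move: h => /andP[h1 h2]; nra.
have C : `|q * X - (1 + (w / 2 - s) + (3 / 8 * w ^+ 2 - 3 / 2 * s * w + s ^+ 2 / 2))| <= 9 * d ^+ 3.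
  have kk : k = 1 + w + w ^+ 2 * k.
    rewrite (_ : 1 + w + w ^+ 2 * k = (1 + w) * (k * (1 - w)) + w ^+ 2 * k); first by ring.
    by rewrite kE mulr1.
  have km1 : k - 1 = w * k by rewrite -kE; ring.
  have k2E : k ^+ 2 = 1 + w * (k * (k + 1)).
    rewrite (_ : k ^+ 2 = 1 + (k - 1) * (k + 1)); last by ring.
    by rewrite km1; ring.
  have XE : X = 1 - s - s * w + s ^+ 2 / 2 - (s * w ^+ 2) * k + (s ^+ 2 * w) * (k * (k + 1) / 2).
    by rewrite /X exprMn k2E {1}kk; field.
  (* What the cancellation leaves carries a factor s w^2 or s^2 w, each at most d^3. *)
  rewrite XE (_ : _ - _ = (s * w ^+ 2) * (- 7 / 8 - 3 / 8 * w - q * k)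
     + (s ^+ 2 * w) * (1 / 4 + 3 / 16 * w + q * (k * (k + 1) / 2))); last by rewrite /q; field.
  have /andP[m1 m1'] := sww; have /andP[m2 m2'] := ssw.
  have c1 : - (9 / 2) <= - 7 / 8 - 3 / 8 * w - q * k <= 0 by nra.
  have kk4 : k ^+ 2 <= 4 by rewrite expr2; nra.
  have kk5 : 1 <= k ^+ 2 by rewrite expr2; nra.
  have kk3 : 1 <= k * (k + 1) / 2 <= 3.
    rewrite (_ : k * (k + 1) / 2 = (k ^+ 2 + k) / 2); last by field.
    by lra.
  have c2 : 0 <= 1 / 4 + 3 / 16 * w + q * (k * (k + 1) / 2) <= 5.
    by move: kk3; move: (k * (k + 1) / 2) => z /andP[z1 z2]; nra.
  move: c1 c2 m1 m1' m2 m2'.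
  move: (s * w ^+ 2) (s ^+ 2 * w) (- 7 / 8 - _ - _) (1 / 4 + _ + _) => a b a' b'.
  move=> /andP[a1 a2] /andP[b1 b2] m1 m1' m2 m2'.
  by rewrite ler_norml; apply/andP; split; nra.
rewrite (_ : p * e - _ = (p - q) * e + q * (e - X)
  + (q * X - (1 + (w / 2 - s) + (3 / 8 * w ^+ 2 - 3 / 2 * s * w + s ^+ 2 / 2)))); last by ring.
apply: le_trans (ler_normD _ _) _.
have := ler_normD ((p - q) * e) (q * (e - X)); lra.
Qed.

(** The exponent 3 is the order of the remainder in [density_ratio_expansion]. The cube has degree
    12 in m, which the decay exp(- m^2 / 2) of [phi] absorbs. *)
Lemma tail_density_moment (R : realType) (x y : R) : exists2 K : R, 0 <= K &
  forall m, 0 < m -> tail_density x y m * (1 + m ^+ 2 + density_rate x y m) ^+ 3 <= K.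
Proof.
pose a := (x + y) / 2.
pose B := 2 * expR (- x) * normal_peak 1 * expR (- ((y - x) / 2)).
have p0 := peak_gt0 R.
have B0 : 0 <= B by rewrite /B !mulr_ge0 ?expR_ge0// ltW.
exists (B * ((1 + a ^+ 2) ^+ 3 * 12 ^+ 6)).
  by rewrite mulr_ge0// mulr_ge0 ?exprn_ge0// addr_ge0// sqr_ge0.
move=> m m0; have z0 : 0 <= m ^+ 2 by exact: sqr_ge0.
have a0 : 0 <= a ^+ 2 by exact: sqr_ge0.
have Q0 : 0 <= density_rate x y m by rewrite /density_rate divr_ge0 ?sqr_ge0.
have M1 : 1 + m ^+ 2 + density_rate x y m <= (1 + a ^+ 2) * (1 + m ^+ 2) ^+ 2.
  have -> : density_rate x y m = (m ^+ 2 + a) ^+ 2 / 2 by [].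
  have := sqr_ge0 (m ^+ 2 - a); move: (m ^+ 2) z0 => z z0 h.
  have := mulr_ge0 a0 z0; have := mulr_ge0 a0 (sqr_ge0 z).
  rewrite (_ : (1 + a ^+ 2) * (1 + z) ^+ 2 = 1 + 2 * z + z ^+ 2 + a ^+ 2
    + 2 * (a ^+ 2 * z) + a ^+ 2 * z ^+ 2); last by ring.
  rewrite (_ : (z + a) ^+ 2 / 2 = z ^+ 2 + a ^+ 2 - (z - a) ^+ 2 / 2); last by field.
  by move=> h1 h2; lra.
have M3 : (1 + m ^+ 2 + density_rate x y m) ^+ 3 <= (1 + a ^+ 2) ^+ 3 * (1 + m ^+ 2) ^+ 6.
  rewrite [(1 + m ^+ 2) ^+ 6](exprM _ 2 3) -exprMn.
  have M0 : 0 <= 1 + m ^+ 2 + density_rate x y m by lra.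
  by rewrite lerXn2r ?nnegrE// (le_trans M0).
have K1 : tail_density x y m <= B * expR (- m ^+ 2 / 2).
  rewrite /tail_density /B phiE -!mulrA ler_pM2l// ler_pM2l ?expR_gt0// ler_pM2l//.
  rewrite -expRD ler_expR.
  have mn : m != 0 by rewrite gt_eqF.
  (* Dropping the square of (y - x) / (2 m) keeps the bound uniform as m tends to 0. *)
  rewrite (_ : - (m + _) ^+ 2 / 2 = - ((y - x) / 2) + - m ^+ 2 / 2 - ((y - x) / (2 * m)) ^+ 2 / 2).
    by rewrite gerDl oppr_le0 divr_ge0 ?sqr_ge0.
  by field.
(* With z = m^2: e^(z/12) >= 1 + z/12 >= (1 + z)/12, raised to the sixth power. *)
have E1 : (1 + m ^+ 2) ^+ 6 * expR (- m ^+ 2 / 2) <= 12 ^+ 6.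
  rewrite mulNr expRN ler_pdivrMr ?expR_gt0//.
  rewrite (_ : m ^+ 2 / 2 = m ^+ 2 / 12 * 6%:R); last by field.
  rewrite expRM_natr -exprMn lerXn2r ?nnegrE ?mulr_ge0 ?expR_ge0 ?addr_ge0//.
  by have := expR_ge1Dx (m ^+ 2 / 12); lra.
apply: le_trans (_ : B * expR (- m ^+ 2 / 2) * ((1 + a ^+ 2) ^+ 3 * (1 + m ^+ 2) ^+ 6) <= _).
  apply: ler_pM => //; last by rewrite exprn_ge0// !addr_ge0.
  by rewrite /tail_density !mulr_ge0 ?expR_ge0// ltW// phi_gt0.
rewrite (_ : _ * _ * (_ * _) = B * ((1 + a ^+ 2) ^+ 3
  * ((1 + m ^+ 2) ^+ 6 * expR (- m ^+ 2 / 2)))); last by ring.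
by rewrite ler_wpM2l// ler_wpM2l// exprn_ge0// addr_ge0.
Qed.

Definition tail_expansion (R : realType) (b x y m : R) : R :=
  tail_term0 x y m + (b ^+ 2)^-1 * tail_term1 x y m + (b ^+ 2)^-1 ^+ 2 * tail_term2 x y m.

(** Mean value theorem for the difference, whose derivative is [tail_density] times the remainder of
    the correction factor. [K] is independent of b and of the interval; 2 m'^2 <= b^2 says that w <=
    1/2. *)
Lemma scaled_tail_expansion (R : realType) (x y : R) : exists2 K : R, 0 <= K &
  forall b m m', 0 < m -> m <= m' -> 2 * m' ^+ 2 <= b ^+ 2 -> 0 < b ->
  `|(scaled_tail b x y m' - scaled_tail b x y m)
    - (tail_expansion b x y m' - tail_expansion b x y m)|
  <= K * (b ^+ 2)^-1 ^+ 3 * m'.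
Proof.
have [K K0 hK] := tail_density_moment x y.
exists (12 * K); first by rewrite mulr_ge0.
move=> b m m' m0 mm' m'b b0; set e := (b ^+ 2)^-1.
have b2 : 0 < b ^+ 2 by rewrite exprn_gt0.
have e0 : 0 < e by rewrite invr_gt0.
pose f t := scaled_tail b x y t + - tail_expansion b x y t.
pose df t := tail_density x y t * ((Num.sqrt (1 - t ^+ 2 / b ^+ 2))^-1
     * expR (- (density_rate x y t / b ^+ 2 / (1 - t ^+ 2 / b ^+ 2)))
     - (1 + e * density_coef1 x y t + e ^+ 2 * density_coef2 x y t)).
have tb t : m <= t <= m' -> [/\ 0 < t, t < b & t ^+ 2 / b ^+ 2 <= 1 / 2].
  move=> /andP[mt tm']; have t0 : 0 < t by lra.
  have t2 : t ^+ 2 <= m' ^+ 2 by rewrite lerXn2r ?nnegrE; lra.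
  have t2' : 0 < t ^+ 2 by rewrite exprn_gt0.
  split => //; last by rewrite ler_pdivrMr//; lra.
  by rewrite -(@ltr_pXn2r _ 2) ?nnegrE ?ltW//; lra.
have [|c cmm' E] := @mean_value R f df m m' mm'.
  move=> t /tb[t0 tlb tb2]; have tn : t != 0 by rewrite gt_eqF.
  apply: has_deriv_conv.
    apply: has_deriv_add; first exact: has_deriv_scaled_tail.
    apply: has_deriv_opp; apply: has_deriv_add.
      apply: has_deriv_add; first exact: has_deriv_tail_term0.
      by apply: has_deriv_mul; [exact: has_deriv_const|exact: has_deriv_tail_term1].
    by apply: has_deriv_mul; [exact: has_deriv_const|exact: has_deriv_tail_term2].
  by rewrite /df -/e /=; ring.
rewrite [X in `|X|](_ : _ = f m' - f m); last first.
  rewrite /f; move: (scaled_tail b x y m') (scaled_tail b x y m) (tail_expansion b x y m') (tail_expansion b x y m).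
  by move=> *; ring.
have [c0 cb cb2] := tb c cmm'.
rewrite E normrM (ger0_norm (_ : 0 <= m' - m)) ?subr_ge0//.
have k0 : 0 <= tail_density x y c by rewrite /tail_density !mulr_ge0 ?expR_ge0// ltW// phi_gt0.
have q0 : 0 <= density_rate x y c by rewrite /density_rate divr_ge0 ?sqr_ge0.
have c2 : 0 < c ^+ 2 by rewrite exprn_gt0.
have D : `|df c| <= 12 * K * e ^+ 3.
  rewrite /df normrM (ger0_norm k0).
  (* [M * e] dominates both small quantities of [density_ratio_expansion] and serves as its [d]. *)
  set M := 1 + c ^+ 2 + density_rate x y c.
  have w0 : 0 <= c ^+ 2 / b ^+ 2 <= 1 / 2 by rewrite cb2 divr_ge0 ?sqr_ge0.
  have s0 : 0 <= density_rate x y c / b ^+ 2 by rewrite divr_ge0// ltW.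
  have wd : c ^+ 2 / b ^+ 2 <= M * e by rewrite ler_pM2r// /M; lra.
  have sd : density_rate x y c / b ^+ 2 <= M * e by rewrite ler_pM2r// /M; lra.
  have := density_ratio_expansion w0 s0 wd sd.
  have -> : 1 + (c ^+ 2 / b ^+ 2 / 2 - density_rate x y c / b ^+ 2)
      + (3 / 8 * (c ^+ 2 / b ^+ 2) ^+ 2 - 3 / 2 * (density_rate x y c / b ^+ 2) * (c ^+ 2 / b ^+ 2)
         + (density_rate x y c / b ^+ 2) ^+ 2 / 2)
      = 1 + e * density_coef1 x y c + e ^+ 2 * density_coef2 x y c.
    by rewrite /density_coef1 /density_coef2 -/e; field.
  move=> /(ler_wpM2l k0) /le_trans; apply.
  have -> : tail_density x y c * (12 * (M * e) ^+ 3) = 12 * e ^+ 3 * (tail_density x y c * M ^+ 3) by ring.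
  have -> : 12 * K * e ^+ 3 = 12 * e ^+ 3 * K by ring.
  by rewrite ler_wpM2l ?hK// mulr_ge0// exprn_ge0// ltW.
apply: ler_pM => //; first by rewrite subr_ge0.
lra.
Qed.

(* [jet e f a0 a1 a2] : f = a0 + a1 e + a2 e^2 + o(e^2). *)
Definition jet (R : realType) (e f : nat -> R) (a0 a1 a2 : R) : Prop :=
  ((f n - a0) / e n - a1) / e n @[n --> \oo] --> a2.

(** * Calculus of second-order expansions *)

Definition small_scale (R : realType) (e : nat -> R) : Prop :=
  e n @[n --> \oo] --> (0 : R) /\ \forall n \near \oo, e n != 0.

Lemma jet_of_expansion (R : realType) (e f r : nat -> R) (a0 a1 a2 : R) :
  small_scale e -> r n @[n --> \oo] --> a2 ->
  (\forall n \near \oo, f n = a0 + a1 * e n + r n * e n ^+ 2) ->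
  jet e f a0 a1 a2.
Proof.
move=> [_ en0] ra fE; apply: cvg_trans ra; apply: near_eq_cvg; near=> n.
have en : e n != 0 by near: n.
have -> : f n = a0 + a1 * e n + r n * e n ^+ 2 by near: n.
by field.
Unshelve. all: by end_near. Qed.

(** The second-order coefficient is traded for a convergent sequence [r], so that products and
    inverses reduce to field identities and limits. *)
Lemma jet_expansion (R : realType) (e f : nat -> R) (a0 a1 a2 : R) :
  small_scale e -> jet e f a0 a1 a2 ->
  exists2 r : nat -> R, r n @[n --> \oo] --> a2 &
    \forall n \near \oo, f n = a0 + a1 * e n + r n * e n ^+ 2.
Proof.
move=> [_ en0] jf; exists (fun n => ((f n - a0) / e n - a1) / e n) => //.
near=> n; have en : e n != 0 by near: n.
by field.
Unshelve. all: by end_near. Qed.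

Lemma jet_near_eq (R : realType) (e f g : nat -> R) (a0 a1 a2 : R) :
  (\forall n \near \oo, f n = g n) -> jet e f a0 a1 a2 -> jet e g a0 a1 a2.
Proof.
move=> fg; apply: cvg_trans; apply: near_eq_cvg; near=> n.
by have -> : f n = g n by near: n.
Unshelve. all: by end_near. Qed.

Lemma jet_eq (R : realType) (e f : nat -> R) (a0 a1 a2 c0 c1 c2 : R) :
  jet e f a0 a1 a2 -> a0 = c0 -> a1 = c1 -> a2 = c2 -> jet e f c0 c1 c2.
Proof. by move=> ? <- <- <-. Qed.

Lemma jet_const (R : realType) (e : nat -> R) (c : R) : jet e (fun=> c) c 0 0.
Proof.
rewrite /jet; under eq_fun do rewrite subrr mul0r subr0 mul0r.
exact: cvg_cst.
Qed.

Lemma jet_id (R : realType) (e : nat -> R) : small_scale e -> jet e e 0 1 0.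
Proof.
move=> he; apply: (@jet_of_expansion _ _ _ (fun=> 0)) => //; first exact: cvg_cst.
by apply: nearW => n; ring.
Qed.

Lemma jet_add (R : realType) (e f g : nat -> R) (a0 a1 a2 c0 c1 c2 : R) :
  jet e f a0 a1 a2 -> jet e g c0 c1 c2 ->
  jet e (fun n => f n + g n) (a0 + c0) (a1 + c1) (a2 + c2).
Proof.
move=> jf jg; rewrite /jet.
rewrite (_ : (fun n => _) = (fun n => ((f n - a0) / e n - a1) / e n
  + ((g n - c0) / e n - c1) / e n)); first exact: cvgD.
by apply/funext => n; ring.
Qed.

Lemma jet_opp (R : realType) (e f : nat -> R) (a0 a1 a2 : R) :
  jet e f a0 a1 a2 -> jet e (fun n => - f n) (- a0) (- a1) (- a2).
Proof.
move=> jf; rewrite /jet.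
rewrite (_ : (fun n => _) = (fun n => - (((f n - a0) / e n - a1) / e n))); first exact: cvgN.
by apply/funext => n; ring.
Qed.

Lemma jet_mul (R : realType) (e f g : nat -> R) (a0 a1 a2 c0 c1 c2 : R) :
  small_scale e -> jet e f a0 a1 a2 -> jet e g c0 c1 c2 ->
  jet e (fun n => f n * g n) (a0 * c0) (a0 * c1 + a1 * c0)
    (a0 * c2 + a1 * c1 + a2 * c0).
Proof.
move=> he; have [e0 en0] := he.
move=> /(jet_expansion he)[r ra fE] /(jet_expansion he)[t ta gE].
apply: (@jet_of_expansion _ _ _ (fun n => a0 * t n + a1 * c1 + r n * c0
  + e n * (a1 * t n + r n * c1) + e n * e n * (r n * t n))) => //.
  rewrite -[X in _ --> X]addr0; apply: cvgD; last first.
    rewrite -(mul0r (a2 * c2)) -(mul0r 0).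
    by apply: cvgM; apply: cvgM.
  rewrite -[X in _ --> X]addr0; apply: cvgD; last first.
    rewrite -(mul0r (a1 * c2 + a2 * c1)); apply: cvgM => //.
    apply: cvgD; first by apply: cvgM => //; exact: cvg_cst.
    by apply: cvgM => //; exact: cvg_cst.
  apply: cvgD; last by apply: cvgM => //; exact: cvg_cst.
  apply: cvgD; last exact: cvg_cst.
  by apply: cvgM => //; exact: cvg_cst.
near=> n.
have -> : f n = a0 + a1 * e n + r n * e n ^+ 2 by near: n.
have -> : g n = c0 + c1 * e n + t n * e n ^+ 2 by near: n.
by ring.
Unshelve. all: by end_near. Qed.

Lemma jet_quotient_cvg (R : realType) (e f : nat -> R) (a0 a1 a2 : R) :
  small_scale e -> jet e f a0 a1 a2 ->
  (f n - a0) / e n @[n --> \oo] --> a1.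
Proof.
move=> he /(jet_expansion he)[r ra fE]; have [e0 en0] := he.
have h : (a1 + r n * e n) @[n --> \oo] --> a1.
  rewrite -[X in _ --> X]addr0 -(mulr0 a2); apply: cvgD; first exact: cvg_cst.
  exact: cvgM.
apply: cvg_trans h; apply: near_eq_cvg; near=> n.
have en : e n != 0 by near: n.
have -> : f n = a0 + a1 * e n + r n * e n ^+ 2 by near: n.
by field.
Unshelve. all: by end_near. Qed.

Lemma jet_cvg (R : realType) (e f : nat -> R) (a0 a1 a2 : R) :
  small_scale e -> jet e f a0 a1 a2 -> f n @[n --> \oo] --> a0.
Proof.
move=> he jf; have q := jet_quotient_cvg he jf; have [e0 en0] := he.
have h : a0 + (f n - a0) / e n * e n @[n --> \oo] --> a0.
  rewrite -[X in _ --> X]addr0 -(mulr0 a1); apply: cvgD; first exact: cvg_cst.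
  exact: cvgM.
apply: cvg_trans h; apply: near_eq_cvg; near=> n.
have en : e n != 0 by near: n.
by field.
Unshelve. all: by end_near. Qed.

Lemma jet_inv (R : realType) (e f : nat -> R) (a0 a1 a2 : R) :
  small_scale e -> a0 != 0 -> jet e f a0 a1 a2 ->
  jet e (fun n => (f n)^-1) a0^-1 (- a1 / a0 ^+ 2) ((a1 ^+ 2 - a0 * a2) / a0 ^+ 3).
Proof.
move=> he a00 jf; have [e0 en0] := he.
have fa := jet_cvg he jf; have qa := jet_quotient_cvg he jf.
have ne : \forall n \near \oo, f n != 0.
  exact: cvgr_neq0 fa a00.
have [r ra fE] := jet_expansion he jf.
apply: (@jet_of_expansion _ _ _ (fun n =>
   (a1 * ((f n - a0) / e n) - a0 * r n) / (a0 ^+ 2 * f n))) => //.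
  rewrite (_ : (a1 ^+ 2 - a0 * a2) / a0 ^+ 3 = (a1 * a1 - a0 * a2) / (a0 ^+ 2 * a0)); last first.
    by rewrite -exprSr expr2.
  apply: cvgM.
    by apply: cvgB; apply: cvgM => //; exact: cvg_cst.
  apply: cvgV; first by rewrite mulf_neq0// expf_neq0.
  by apply: cvgM => //; exact: cvg_cst.
near=> n.
have en : e n != 0 by near: n.
have fn : f n != 0 by near: n.
have E : f n = a0 + a1 * e n + r n * e n ^+ 2 by near: n.
have E' : r n = (f n - a0 - a1 * e n) / e n ^+ 2 by rewrite E; field.
by rewrite E'; field; rewrite en fn a00.
Unshelve. all: by end_near. Qed.

(** The derivative [g1] need only be differentiable at [a]: subtracting the quadratic polynomial
    leaves a function whose derivative is o(h) between a and a + h, and the mean value theorem gives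
    the extra factor |h|. *)
Lemma peano2 (R : realType) (g g1 : R -> R) (a d2 : R) :
  (\forall t \near a, has_deriv g t (g1 t)) -> has_deriv g1 a d2 ->
  forall d, 0 < d -> exists2 h0, 0 < h0 & forall h, `|h| < h0 ->
    `|g (a + h) - g a - g1 a * h - d2 / 2 * h ^+ 2| <= d * h ^+ 2.
Proof.
(* Caratheodory's slope: g1(t) - g1(a) = c(t) (t - a) with [c] continuous at [a] and c(a) = d2. *)
move=> dg /is_derive1_caratheodory[c [cE cc ca]] d d0.
have /cvgrPdist_le /(_ d d0) cd : c t @[t --> a] --> c a := cc.
have [/= h1 h10 H1] := dg.
have [/= h2 h20 H2] := cd.
exists (Num.min h1 h2); first by rewrite lt_min h10.
move=> h; rewrite lt_min => /andP[hh1 hh2].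
pose f t := g t + - (g1 a * (t - a)) + - (d2 / 2 * (t - a) ^+ 2).
pose df t := g1 t - g1 a - d2 * (t - a).
have dfE t : `|t - a| <= `|h| -> has_deriv f t (df t).
  move=> th; apply: has_deriv_conv.
    apply: has_deriv_add; first apply: has_deriv_add.
    - by apply: H1; rewrite /ball_/= distrC (le_lt_trans th).
    - by derive.
    - by derive.
  by rewrite /df /=; field.
have dfb t : `|t - a| <= `|h| -> `|df t| <= d * `|h|.
  move=> th; rewrite /df cE -ca -mulrBl normrM ler_pM//.
  by rewrite distrC; apply: H2; rewrite /ball_/= distrC (le_lt_trans th).
have bound s t : s <= t -> (forall z, s <= z <= t -> `|z - a| <= `|h|) -> t - s = `|h| ->
    `|f t - f s| <= d * h ^+ 2.
  move=> st hz tsh; have [|z zz ->] := @mean_value R f df s t st.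
    by move=> z /hz /dfE.
  rewrite normrM tsh normr_id -real_normK ?num_real// expr2 mulrA.
  by rewrite ler_wpM2r// dfb// hz.
have fE : f (a + h) - f a = g (a + h) - g a - g1 a * h - d2 / 2 * h ^+ 2.
  by rewrite /f subrr (addrC a) addrK expr0n/=; ring.
rewrite -fE; have [hge|hlt] := leP 0 h.
  apply: bound; rewrite ?lerDl//; last by rewrite addrAC subrr add0r ger0_norm.
  by move=> z /andP[z1 z2]; rewrite (ger0_norm hge) ger0_norm; lra.
rewrite distrC; apply: bound; first by lra.
  by move=> z /andP[z1 z2]; rewrite (ltr0_norm hlt) ler0_norm; lra.
by rewrite (ltr0_norm hlt); lra.
Qed.

(** Since (f - a0) / e converges, the Peano remainder o((f - a0)^2) is o(e^2). *)
Lemma jet_comp (R : realType) (e f : nat -> R) (g g1 : R -> R) (a0 a1 a2 d2 : R) :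
  small_scale e -> jet e f a0 a1 a2 ->
  (\forall t \near a0, has_deriv g t (g1 t)) -> has_deriv g1 a0 d2 ->
  jet e (fun n => g (f n)) (g a0) (g1 a0 * a1) (g1 a0 * a2 + d2 / 2 * a1 ^+ 2).
Proof.
move=> he jf dg dg1; have [e0 en0] := he; have P := peano2 dg dg1.
have fa := jet_cvg he jf; have qa := jet_quotient_cvg he jf.
have ha : f n - a0 @[n --> \oo] --> (0 : R).
  by rewrite -(subrr a0); apply: cvgB => //; exact: cvg_cst.
pose rem n := g (f n) - g a0 - g1 a0 * (f n - a0) - d2 / 2 * (f n - a0) ^+ 2.
have rem0 : rem n / e n ^+ 2 @[n --> \oo] --> (0 : R).
  apply/cvgr0Pnorm_le => d d0.
  (* An eventual bound for ((f - a0) / e)^2, which tends to a1^2; the Peano estimate is taken at d /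
     k. *)
  pose k := a1 ^+ 2 + 1.
  have k0 : 0 < k by rewrite ltr_wpDl ?sqr_ge0.
  have [h0 h00 Hh] := P (d / k) (divr_gt0 d0 k0).
  have q2 : ((f n - a0) / e n) ^+ 2 @[n --> \oo] --> a1 ^+ 2.
    by rewrite !expr2; under eq_fun do rewrite expr2; apply: cvgM.
  have nearh : \forall n \near \oo, `|f n - a0| < h0.
    by move/cvgr0Pnorm_lt : ha => /(_ _ h00).
  have nearq : \forall n \near \oo, ((f n - a0) / e n) ^+ 2 <= k.
    by apply: cvgr_le q2 _ _; rewrite /k ltrDl.
  near=> n.
  have en : e n != 0 by near: n.
  have hn : `|f n - a0| < h0 by near: n.
  have qn : ((f n - a0) / e n) ^+ 2 <= k by near: n.
  have e2 : 0 < e n ^+ 2 by rewrite exprn_even_gt0.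
  have := Hh _ hn; rewrite addrCA subrr addr0 -/(rem n) => hr.
  rewrite normrM normfV (gtr0_norm e2) ler_pdivrMr// (le_trans hr)//.
  rewrite -mulrA ler_pM2l// ler_pdivrMl//.
  move: qn; rewrite expr_div_n ler_pdivrMr//; lra.
have [r ra fE] := jet_expansion he jf.
apply: (@jet_of_expansion _ _ _ (fun n => g1 a0 * r n
   + d2 / 2 * (((f n - a0) / e n) * ((f n - a0) / e n)) + rem n / e n ^+ 2)) => //.
  rewrite -[X in _ --> X]addr0; apply: cvgD => //; apply: cvgD.
    by apply: cvgM => //; exact: cvg_cst.
  by apply: cvgM; [exact: cvg_cst|rewrite expr2; apply: cvgM].
near=> n.
have en : e n != 0 by near: n.
have E : f n = a0 + a1 * e n + r n * e n ^+ 2 by near: n.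
have E' : r n = (f n - a0 - a1 * e n) / e n ^+ 2 by rewrite E; field.
by rewrite E' /rem; field.
Unshelve. all: by end_near. Qed.

Lemma jet_expR (R : realType) (e f : nat -> R) (a0 a1 a2 : R) :
  small_scale e -> jet e f a0 a1 a2 ->
  jet e (fun n => expR (f n)) (expR a0) (expR a0 * a1) (expR a0 * (a2 + a1 ^+ 2 / 2)).
Proof.
move=> he jf.
have d : \forall t \near a0, has_deriv expR t (expR t).
  by near=> t; exact: is_derive_expR.
apply: (jet_eq (jet_comp he jf d (is_derive_expR a0))) => //.
by field.
Unshelve. all: by end_near. Qed.

Lemma jet_negligible (R : realType) (e f : nat -> R) :
  small_scale e -> f n / e n ^+ 2 @[n --> \oo] --> (0 : R) -> jet e f 0 0 0.
Proof.
move=> he f0; apply: (jet_of_expansion he f0); have [_ en0] := he.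
near=> n; have en : e n != 0 by near: n.
by field.
Unshelve. all: by end_near. Qed.

(** * Decay faster than every power *)

Definition fast_decay (R : realType) (m f : nat -> R) : Prop :=
  forall k, m n ^+ k * f n @[n --> \oo] --> (0 : R).

Lemma fast_decay_add (R : realType) (m f g : nat -> R) :
  fast_decay m f -> fast_decay m g -> fast_decay m (fun n => f n + g n).
Proof.
move=> hf hg k; under eq_fun do rewrite mulrDr.
by rewrite -(addr0 0); exact: cvgD.
Qed.

Lemma fast_decay_scale (R : realType) (m f : nat -> R) (c : R) (j : nat) :
  fast_decay m f -> fast_decay m (fun n => c * m n ^+ j * f n).
Proof.
move=> hf k; rewrite (_ : (fun n => _) = (fun n => c * (m n ^+ (k + j) * f n))).
  by rewrite -(mulr0 c); apply: cvgM => //; exact: cvg_cst.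
by apply/funext => n; rewrite exprD; ring.
Qed.

Lemma fast_decay_le (R : realType) (m f g : nat -> R) :
  m n @[n --> \oo] --> +oo -> (\forall n \near \oo, `|f n| <= g n) ->
  fast_decay m g -> fast_decay m f.
Proof.
move=> my fg hg k; apply: norm_cvg0.
apply: (@squeeze_cvgr _ _ _ _ (cst 0) (fun n => m n ^+ k * g n)) => //; last exact: cvg_cst.
have m0 : \forall n \near \oo, 0 < m n by move/cvgryPgt : my; apply.
near=> n; have mn : 0 < m n by near: n.
have mk : 0 <= m n ^+ k by rewrite exprn_ge0// ltW.
have fgn : `|f n| <= g n by near: n.
by rewrite normr_ge0/= normrM (ger0_norm mk) ler_wpM2l.
Unshelve. all: by end_near. Qed.

(** The term of order k + 1 in the series of exp(t^2 / 2) gives t^(2k+2) exp(- t^2 / 2) <= 2^(k+1)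
    (k+1)!, hence the bound C / t for t >= 1. *)
Lemma fast_decay_phi (R : realType) (m : nat -> R) (c : R) :
  m n @[n --> \oo] --> +oo -> fast_decay m (fun n => phi (m n + c / (2 * m n))).
Proof.
move=> my k; pose C := normal_peak 1 * expR (- (c / 2)) * (2 ^+ k.+1 * k.+1`!%:R) : R.
have i0 : C * (m n)^-1 @[n --> \oo] --> (0 : R).
  rewrite -(mulr0 C); apply: cvgM; first exact: cvg_cst.
  by apply/gtr0_cvgV0 => //; move/cvgryPgt : my; apply.
apply: (@squeeze_cvgr _ _ _ _ (cst 0) _ _ _ _ _ i0); last exact: cvg_cst.
have m1 : \forall n \near \oo, 1 <= m n by move/cvgryPge : my; apply.
near=> n; have mn1 : 1 <= m n by near: n.
move: (m n) mn1 => t t1; have t0 : 0 < t by lra.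
apply/andP; split; first by rewrite mulr_ge0 ?exprn_ge0 ?ltW// phi_gt0.
have tn : t != 0 by rewrite gt_eqF.
have P1 : phi (t + c / (2 * t)) <= normal_peak 1 * expR (- (c / 2)) * expR (- (t ^+ 2 / 2)).
  rewrite phiE -mulrA ler_pM2l ?peak_gt0// -expRD ler_expR.
  rewrite (_ : - (t + _) ^+ 2 / 2 = - (c / 2) + - (t ^+ 2 / 2) - (c / (2 * t)) ^+ 2 / 2).
    by rewrite gerDl oppr_le0 divr_ge0 ?sqr_ge0.
  by field.
have tk0 : 0 < t ^+ k by rewrite exprn_gt0.
apply: le_trans (ler_wpM2l (ltW tk0) P1) _.
rewrite /C -2!mulrA mulrCA -[leRHS]mulrA ler_pM2l ?peak_gt0//.
rewrite mulrCA -[leRHS]mulrA ler_pM2l ?expR_gt0//.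
have h2 : 0 <= t ^+ 2 / 2 by rewrite divr_ge0 ?sqr_ge0.
have := expR_ge1Dxn k h2.
set E := expR _; set F := (_`!%:R : R) => hE.
have F0 : 0 < F by rewrite ltr0n fact_gt0.
have E0 : 0 < E := expR_gt0 _.
rewrite expRN -/E ler_pdivrMr// mulrAC ler_pdivlMr// -exprSr.
have hE2 : (t ^+ 2 / 2) ^+ k.+1 <= E * F.
  by rewrite -ler_pdivrMr//; lra.
have : t ^+ k.+1 * t ^+ k.+1 <= 2 ^+ k.+1 * F * E.
  have -> : t ^+ k.+1 * t ^+ k.+1 = 2 ^+ k.+1 * (t ^+ 2 / 2) ^+ k.+1.
    by rewrite -!exprMn; congr (_ ^+ _); field.
  by rewrite -mulrA ler_pM2l ?exprn_gt0// (mulrC F).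
have tk1 : 1 <= t ^+ k.+1 by rewrite exprn_ege1.
by apply: le_trans; rewrite ler_peMr// ltW// exprn_gt0.
Unshelve. all: by end_near. Qed.

Lemma cvgy_perturb (R : realType) (m : nat -> R) (c : R) :
  m n @[n --> \oo] --> +oo -> (m n + c / (2 * m n)) @[n --> \oo] --> +oo.
Proof.
move=> my; apply/cvgryPge => A.
have m1 : \forall n \near \oo, Num.max 1 (A + `|c|) <= m n by move/cvgryPge : my; apply.
near=> n; have : Num.max 1 (A + `|c|) <= m n by near: n.
rewrite ge_max => /andP[t1 tA].
move: (m n) t1 tA => t t1 tA; have t0 : 0 < t by lra.
have : - `|c| <= c / (2 * t).
  rewrite ler_pdivlMr ?mulr_gt0//.
  have := ler_norm (- c); rewrite normrN; have := normr_ge0 c; nra.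
lra.
Unshelve. all: by end_near. Qed.

Lemma fast_decay_Phibar (R : realType) (m : nat -> R) (c : R) :
  m n @[n --> \oo] --> +oo -> fast_decay m (fun n => Phibar (m n + c / (2 * m n))).
Proof.
move=> my.
(* For t >= 1 the Mills bound t^-1 - t^-3 + 3 t^-5 is at most 3; the power 0 fits the form of
   [fast_decay_scale]. *)
apply: (@fast_decay_le _ _ _ (fun n => 3 * m n ^+ 0 * phi (m n + c / (2 * m n)))) => //; last first.
  by apply: fast_decay_scale; exact: fast_decay_phi.
have t1 : \forall n \near \oo, 1 <= m n + c / (2 * m n).
  by move/(cvgy_perturb c)/cvgryPge : my; apply.
near=> n; have : 1 <= m n + c / (2 * m n) by near: n.
move: (m n + _) => t tge1; have t0 : 0 < t by lra.
rewrite gtr0_norm ?Phibar_gt0// expr0 mulr1 mulrC.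
apply: le_trans (Phibar_upper t0) _; rewrite ler_pM2l ?phi_gt0//.
have i0 : 0 < t^-1 by rewrite invr_gt0.
have i1 : t^-1 <= 1 by rewrite invf_le1.
have h5 : t^-1 ^+ 5 <= t^-1 ^+ 3 by rewrite ler_wiXn2l ?(ltW i0).
have h3 : t^-1 ^+ 3 <= 1 by rewrite exprn_ile1// ltW.
lra.
Unshelve. all: by end_near. Qed.

Lemma small_scale_inv_sqr (R : realType) (b : nat -> R) :
  b n @[n --> \oo] --> +oo -> small_scale (fun n => (b n ^+ 2)^-1).
Proof.
move=> b_oo.
have b1 : \forall n \near \oo, 1 <= b n by move/cvgryPge : b_oo; apply.
have b0 : \forall n \near \oo, 0 < b n by move/cvgryPgt : b_oo; apply.
split; last first.
  near=> n; have : 0 < b n by near: n.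
  by move=> bn; rewrite invr_eq0 expf_neq0// gt_eqF.
have i0 : (b n)^-1 @[n --> \oo] --> (0 : R) by apply/gtr0_cvgV0.
apply: (@squeeze_cvgr _ _ _ _ (cst 0) _ _ _ _ _ i0); last exact: cvg_cst.
near=> n; have bn : 1 <= b n by near: n.
have bn0 : 0 < b n by lra.
rewrite invr_ge0 exprn_ge0 ?(ltW bn0)//= lef_pV2 ?posrE ?exprn_gt0//.
by rewrite -[leLHS]expr1 ler_weXn2l.
Unshelve. all: by end_near. Qed.

(** * Expansion of the univariate tail *)

Definition scaled_Phibar (R : realType) (b z : R) : R := b / phi b * Phibar (b + z / b).

Lemma Phibar_mills (R : realType) (u : R) : 0 < u ->
  `|u * Phibar u / phi u - (1 - (u ^+ 2)^-1 + 3 * (u ^+ 2)^-1 ^+ 2)|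
  <= 15 * (u ^+ 2)^-1 ^+ 3.
Proof.
move=> u0; have p0 := phi_gt0 u; have un : u != 0 by rewrite gt_eqF.
have hU := Phibar_upper u0; have hL := Phibar_lower u0.
have pn : phi u != 0 by rewrite gt_eqF.
have v0 : 0 < (u ^+ 2)^-1 by rewrite invr_gt0 exprn_gt0.
have U : u * Phibar u / phi u <= 1 - (u ^+ 2)^-1 + 3 * (u ^+ 2)^-1 ^+ 2.
  rewrite ler_pdivrMr// -ler_pdivlMl//; apply: le_trans hU _.
  by rewrite le_eqVlt; apply/orP; left; apply/eqP; field.
have L : 1 - (u ^+ 2)^-1 + 3 * (u ^+ 2)^-1 ^+ 2 - 15 * (u ^+ 2)^-1 ^+ 3 <= u * Phibar u / phi u.
  rewrite ler_pdivlMr// -ler_pdivrMl//; apply: le_trans hL.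
  by rewrite le_eqVlt; apply/orP; left; apply/eqP; field.
have : 0 <= (u ^+ 2)^-1 ^+ 3 by rewrite exprn_ge0// ltW.
by rewrite ler_norml; lra.
Qed.

(** With u = b (1 + z eps), the scaled tail is the product of u Phibar(u) / phi(u), of 1 / (1 + z
    eps), and of phi(u) / phi(b), which is exactly exp(- z - z^2 eps / 2). *)
Lemma jet_scaled_Phibar (R : realType) (b : nat -> R) (z : R) :
  b n @[n --> \oo] --> +oo ->
  jet (fun n => (b n ^+ 2)^-1) (fun n => scaled_Phibar (b n) z)
    (expR (- z)) (pol1 z * expR (- z)) (pol2 z * expR (- z)).
Proof.
move=> b_oo; set e := fun n => (b n ^+ 2)^-1.
have he : small_scale e := small_scale_inv_sqr b_oo.
have [e0 en0] := he.
have b0 : \forall n \near \oo, 0 < b n by move/cvgryPgt : b_oo; apply.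
have j1 : jet e (fun n => 1 + z * e n) 1 z 0.
  apply: (jet_eq (jet_add (jet_const e 1) (jet_mul he (jet_const e z) (jet_id he)))); ring.
have jq := jet_inv he (oner_neq0 R) j1.
(* [v n] is u^-2, the variable of the Mills series. *)
pose v n := e n * ((1 + z * e n)^-1 * (1 + z * e n)^-1).
have jv : jet e v 0 1 (- 2 * z).
  by apply: (jet_eq (jet_mul he (jet_id he) (jet_mul he jq jq))); field.
pose N n := (b n + z / b n) * Phibar (b n + z / b n) / phi (b n + z / b n).
have ub : \forall n \near \oo, 0 < 1 + z * e n.
  by apply: (cvgr_gt _ (jet_cvg he j1)); exact: ltr01.
have jN0 : jet e (fun n => 1 + - v n + 3 * (v n * v n)) 1 (-1) (2 * z + 3).
  apply: (jet_eq (jet_add (jet_add (jet_const e 1) (jet_opp jv))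
    (jet_mul he (jet_const e 3) (jet_mul he jv jv)))); ring.
have jN : jet e N 1 (-1) (2 * z + 3).
  have small : jet e (fun n => N n - (1 + - v n + 3 * (v n * v n))) 0 0 0.
    apply: jet_negligible => //.
    (* This is 15 v^3 / e^2, arranged to show that it tends to 0. *)
    have ve : 15 * (v n / e n) ^+ 2 * v n @[n --> \oo] --> (0 : R).
      have h : v n / e n @[n --> \oo] --> (1 : R).
        by have := jet_quotient_cvg he jv; under eq_fun do rewrite subr0.
      have h' := jet_cvg he jv.
      rewrite -(mulr0 (15 * (1 * 1))); under eq_fun do rewrite expr2.
      by apply: cvgM => //; apply: cvgM; [exact: cvg_cst|exact: cvgM].
    apply: norm_cvg0; apply: (@squeeze_cvgr _ _ _ _ (cst 0) _ _ _ _ _ ve); last exact: cvg_cst.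
    near=> n; rewrite normr_ge0/=.
    have bn : 0 < b n by near: n.
    have un : 0 < 1 + z * e n by near: n.
    have en : e n != 0 by near: n.
    have bnn : b n != 0 by rewrite gt_eqF.
    have uE : b n + z / b n = b n * (1 + z * e n) by rewrite /e; field.
    have u0 : 0 < b n + z / b n by rewrite uE mulr_gt0.
    have vE : v n = ((b n + z / b n) ^+ 2)^-1.
      rewrite uE /v exprMn invfM (expr2 (1 + _)). by rewrite [X in _ = _ * X]invfM.
    have := Phibar_mills u0; rewrite -vE -/(N n) => h.
    have e2 : 0 < e n ^+ 2 by rewrite exprn_even_gt0.
    rewrite normrM normfV (gtr0_norm e2) ler_pdivrMr//.
    have -> : 15 * (v n / e n) ^+ 2 * v n * e n ^+ 2 = 15 * v n ^+ 3 by field.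
    by rewrite -expr2.
  apply: jet_near_eq (jet_eq (jet_add small jN0) _ _ _); last 3 first.
  - by rewrite add0r.
  - by rewrite add0r.
  - by rewrite add0r.
  by near=> n; rewrite subrK.
have jE : jet e (fun n => expR (- z + - (z ^+ 2 / 2) * e n))
    (expR (- z)) (expR (- z) * - (z ^+ 2 / 2)) (expR (- z) * (z ^+ 4 / 8)).
  have j : jet e (fun n => - z + - (z ^+ 2 / 2) * e n) (- z) (- (z ^+ 2 / 2)) 0.
    by apply: (jet_eq (jet_add (jet_const e (- z)) (jet_mul he (jet_const e (- (z ^+ 2 / 2))) (jet_id he)))); ring.
  by apply: (jet_eq (jet_expR he j)) => //; field.
have J := jet_mul he (jet_mul he jN jq) jE.
apply: jet_near_eq (jet_eq J _ _ _); last 3 first.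
- by field.
- by rewrite /pol1; field.
- by rewrite /pol2; field.
near=> n.
have bn : 0 < b n by near: n.
have un : 0 < 1 + z * e n by near: n.
have bnn : b n != 0 by rewrite gt_eqF.
have unn : 1 + z * e n != 0 by rewrite gt_eqF.
rewrite /N /scaled_Phibar.
have pE : phi (b n + z / b n) = phi (b n) * expR (- z + - (z ^+ 2 / 2) * e n).
  rewrite !phiE -mulrA -expRD; congr (_ * expR _).
  by rewrite /e; field.
have uE : b n + z / b n = b n * (1 + z * e n) by rewrite /e; field.
rewrite pE {1}uE; move: (Phibar _) => P.
have p0 : phi (b n) != 0 by rewrite gt_eqF ?phi_gt0.
have e0' : expR (- z + - (z ^+ 2 / 2) * e n) != 0 by rewrite gt_eqF ?expR_gt0.
by field; rewrite p0 e0' unn.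
Unshelve. all: by end_near. Qed.

(** Division by eps^2 is multiplication by b^4, a power of [m] up to a constant. *)
Lemma jet_fast_decay (R : realType) (b m f : nat -> R) (c : R) :
  b n @[n --> \oo] --> +oo -> (forall n, b n = c * m n) -> fast_decay m f ->
  jet (fun n => (b n ^+ 2)^-1) f 0 0 0.
Proof.
move=> b_oo bm hf; apply: jet_negligible; first exact: small_scale_inv_sqr.
rewrite (_ : (fun n => _) = (fun n => c ^+ 4 * (m n ^+ 4 * f n))).
  by rewrite -(mulr0 (c ^+ 4)); apply: cvgM; [exact: cvg_cst|exact: hf].
by apply/funext => n; rewrite -exprVn invrK bm; ring.
Qed.

(** * Matching at zero correlation *)

(** Both arguments of [Phi] tend to plus infinity, where [Phibar] is smaller than every power of
    eps, as is the [phi] term by hypothesis. *)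
Lemma jet_tail_sum_y (R : realType) (b m r : nat -> R) (c p q x y : R) :
  b n @[n --> \oo] --> +oo -> m n @[n --> \oo] --> +oo ->
  (forall n, b n = c * m n) ->
  fast_decay m (fun n => r n * phi (m n + (y - x) / (2 * m n))) ->
  jet (fun n => (b n ^+ 2)^-1) (fun n => tail_sum p q (r n) x y (m n))
    (p * expR (- x) + q * expR (- y)) 0 0.
Proof.
move=> b_oo my bm hr; set e := fun n => _.
have he : small_scale e := small_scale_inv_sqr b_oo.
have d1 := jet_fast_decay b_oo bm (fast_decay_Phibar (y - x) my).
have d2 := jet_fast_decay b_oo bm (fast_decay_Phibar (x - y) my).
have d3 := jet_fast_decay b_oo bm hr.
have J := jet_add (jet_add
   (jet_mul he (jet_const e (p * expR (- x))) (jet_add (jet_const e 1) (jet_opp d1)))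
   (jet_mul he (jet_const e (q * expR (- y))) (jet_add (jet_const e 1) (jet_opp d2))))
   (jet_mul he (jet_const e (expR (- x))) d3).
apply: jet_near_eq (jet_eq J _ _ _); [|ring..].
apply: nearW => n; rewrite /tail_sum /Phibar !subKr.
by rewrite -/(phi _); ring.
Qed.

(** Inclusion and exclusion for independent coordinates: 1 - P Q = (1 - P) + (1 - Q) - (1 - P) (1 -
    Q). *)
Lemma scaled_tail_endpoint (R : realType) (b x y : R) : 0 < b ->
  scaled_tail b x y (b / Num.sqrt 2) =
  scaled_Phibar b x + scaled_Phibar b y
  - scaled_Phibar b x * Phibar (b + y / b).
Proof.
move=> b0; have bn : b != 0 by rewrite gt_eqF.
rewrite /scaled_tail expr_div_n sqr_sqrtr//.
have -> : 1 - 2 * (b ^+ 2 / 2) / b ^+ 2 = 0 by field.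
rewrite bigauss_cdf0 /scaled_Phibar /Phibar.
by move: (Phi (b + x / b)) (Phi (b + y / b)) (b / phi b) => P Q c; ring.
Qed.

(** The constants of integration are right: both terms expand with the coefficients [pol1] and
    [pol2] at x and y, and the product of two tails is negligible. *)
Lemma jet_endpoint (R : realType) (b : nat -> R) (x y : R) :
  b n @[n --> \oo] --> +oo ->
  jet (fun n => (b n ^+ 2)^-1)
    (fun n => scaled_tail (b n) x y (b n / Num.sqrt 2)
              - tail_expansion (b n) x y (b n / Num.sqrt 2)) 0 0 0.
Proof.
move=> b_oo; set e := fun n => _; pose m n := b n / Num.sqrt 2.
have he : small_scale e := small_scale_inv_sqr b_oo.
have s0 : 0 < Num.sqrt 2 :> R by rewrite sqrtr_gt0.
have my : m n @[n --> \oo] --> +oo.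
  apply/cvgryPge => A; have /cvgryPge /(_ (A * Num.sqrt 2)) := b_oo.
  by apply: filterS => n; rewrite /m ler_pdivlMr.
have bm n : b n = Num.sqrt 2 * m n by rewrite /m mulrC divfK// gt_eqF.
have dphi := fast_decay_phi (y - x) my.
have m0 : jet e (fun n => tail_term0 x y (m n)) (expR (- x) + expR (- y)) 0 0.
  have h0 : fast_decay m (fun n => 0 * phi (m n + (y - x) / (2 * m n))).
    by have := fast_decay_scale 0 0 dphi; under eq_fun do rewrite mul0r.
  by apply: (jet_eq (jet_tail_sum_y 1 1 b_oo my bm h0)); ring.
have m1 : jet e (fun n => tail_term1 x y (m n)) (pol1 x * expR (- x) + pol1 y * expR (- y)) 0 0.
  apply: (@jet_tail_sum_y _ b m (fun n => mid1 x y (m n)) _ _ _ _ _ b_oo my bm).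
  have := fast_decay_add (fast_decay_scale 1 3 dphi) (fast_decay_scale (x + y + 2) 1 dphi).
  congr fast_decay; apply/funext => n; rewrite /mid1.
  by move: (phi _) => P; ring.
have m2 : jet e (fun n => tail_term2 x y (m n)) (pol2 x * expR (- x) + pol2 y * expR (- y)) 0 0.
  apply: (@jet_tail_sum_y _ b m (fun n => mid2 x y (m n)) _ _ _ _ _ b_oo my bm).
  have := fast_decay_add (fast_decay_add (fast_decay_add
    (fast_decay_scale (- (1 / 4)) 7 dphi)
    (fast_decay_scale (- (1 / 4 + (x + y) / 2)) 5 dphi))
    (fast_decay_scale (- (2 + x + y + 5 / 8 * x * y + 7 / 16 * (x ^+ 2 + y ^+ 2))) 3 dphi))
    (fast_decay_scale (- ((x ^+ 3 + y ^+ 3 + x * y ^+ 2 + x ^+ 2 * y) / 4 + x ^+ 2 + y ^+ 2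
            + x * y + 2 * x + 2 * y + 4 + x + y + 2)) 1 dphi).
  congr fast_decay; apply/funext => n; rewrite /mid2.
  by move: (phi _) => P; field.
have jx := jet_scaled_Phibar (z := x) b_oo; have jy := jet_scaled_Phibar (z := y) b_oo.
(* y / b is written as 2 y / (2 b), the form of the perturbation in [fast_decay_Phibar]. *)
have dy : jet e (fun n => Phibar (b n + 2 * y / (2 * b n))) 0 0 0.
  apply: (@jet_fast_decay _ b b _ 1 b_oo); first by move=> n; rewrite mul1r.
  exact: fast_decay_Phibar.
have jm := jet_add (jet_add m0 (jet_mul he (jet_id he) m1))
  (jet_mul he (jet_mul he (jet_id he) (jet_id he)) m2).
have J := jet_add (jet_add (jet_add jx jy) (jet_opp (jet_mul he jx dy))) (jet_opp jm).
apply: jet_near_eq (jet_eq J _ _ _); [|ring..].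
have b0 : \forall n \near \oo, 0 < b n by move/cvgryPgt : b_oo; apply.
near=> n; have bn : 0 < b n by near: n.
have -> : b n + 2 * y / (2 * b n) = b n + y / b n by field; rewrite gt_eqF.
by rewrite scaled_tail_endpoint.
Unshelve. all: by end_near. Qed.

(** * Transport of the expansion to m = lambda_n *)

Lemma has_deriv_tail_density (R : realType) (x y m : R) : m != 0 ->
  has_deriv (tail_density x y) m
    (- tail_density x y m * (m + (y - x) / (2 * m)) * (1 - (y - x) / (2 * m ^+ 2))).
Proof.
move=> m0; have m2 : 2 * m != 0 by rewrite mulf_neq0// pnatr_eq0.
apply: has_deriv_conv.
  by apply: has_deriv_mul; [exact: has_deriv_const|apply: has_deriv_phi_comp; derive].
by rewrite /tail_density /=; move: (phi _) => P; field.
Qed.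

Lemma near_neq0 (R : realType) (l : R) : 0 < l -> \forall t \near l, t != 0.
Proof.
by move=> l0; near=> t; rewrite gt_eqF//; near: t; exact: lt_nbhsr.
Unshelve. all: by end_near. Qed.

(** As [tail_term1] enters with a factor eps and [tail_term2] with eps^2, only the value and first
    derivative of the former and the value of the latter count. *)
Lemma jet_tail_expansion (R : realType) (b mu : nat -> R) (x y l a1 a2 : R) :
  b n @[n --> \oo] --> +oo -> 0 < l ->
  jet (fun n => (b n ^+ 2)^-1) mu l a1 a2 ->
  jet (fun n => (b n ^+ 2)^-1) (fun n => tail_expansion (b n) x y (mu n))
    (tail_term0 x y l)
    (tail_density x y l * a1 + tail_term1 x y l)
    (tail_density x y l * a2
     - tail_density x y l * (l + (y - x) / (2 * l)) * (1 - (y - x) / (2 * l ^+ 2)) / 2 * a1 ^+ 2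
     + tail_density x y l * density_coef1 x y l * a1 + tail_term2 x y l).
Proof.
move=> b_oo l0; set e := fun n => _ => jmu.
have he : small_scale e := small_scale_inv_sqr b_oo.
have ln : l != 0 by rewrite gt_eqF.
have dk := has_deriv_tail_density x y ln.
have nz := near_neq0 l0.
have d0 : \forall t \near l, has_deriv (tail_term0 x y) t (tail_density x y t).
  by apply: filterS nz => t; exact: has_deriv_tail_term0.
have d1 : \forall t \near l, has_deriv (tail_term1 x y) t (tail_density x y t * density_coef1 x y t).
  by apply: filterS nz => t; exact: has_deriv_tail_term1.
have d2 : \forall t \near l, has_deriv (tail_term2 x y) t (tail_density x y t * density_coef2 x y t).
  by apply: filterS nz => t; exact: has_deriv_tail_term2.
(* [jet_comp] asks for second derivatives; [k1] and [k2] only affect orders beyond eps^2, so their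
   existence is enough. *)
have [k1 dk1] : exists k, has_deriv (fun t => tail_density x y t * density_coef1 x y t) l k.
  by eexists; apply: has_deriv_mul; [exact: dk|rewrite /density_coef1 /density_rate; derive].
have [k2 dk2] : exists k, has_deriv (fun t => tail_density x y t * density_coef2 x y t) l k.
  by eexists; apply: has_deriv_mul; [exact: dk|rewrite /density_coef2 /density_rate; derive].
have J := jet_add (jet_add (jet_comp he jmu d0 dk) (jet_mul he (jet_id he) (jet_comp he jmu d1 dk1)))
  (jet_mul he (jet_mul he (jet_id he) (jet_id he)) (jet_comp he jmu d2 dk2)).
apply: (jet_eq J); move: (tail_term0 x y l) (tail_term1 x y l) (tail_term2 x y l) => A B C.
- by ring.
- by ring.
- by field.
Qed.

(** Between mu_n and b_n / sqrt 2 the error is at most K eps^3 b_n / sqrt 2, which after division by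
    eps^2 is of order 1 / b_n. *)
Lemma jet_scaled_tail (R : realType) (b mu : nat -> R) (x y l a1 a2 c0 c1 c2 : R) :
  b n @[n --> \oo] --> +oo -> 0 < l ->
  jet (fun n => (b n ^+ 2)^-1) mu l a1 a2 ->
  jet (fun n => (b n ^+ 2)^-1) (fun n => tail_expansion (b n) x y (mu n)) c0 c1 c2 ->
  jet (fun n => (b n ^+ 2)^-1) (fun n => scaled_tail (b n) x y (mu n)) c0 c1 c2.
Proof.
move=> b_oo l0; set e := fun n => _ => jmu jm.
have he : small_scale e := small_scale_inv_sqr b_oo.
have [K K0 hK] := scaled_tail_expansion x y.
have je := jet_endpoint x y b_oo.
pose m n := b n / Num.sqrt 2.
pose rem n := scaled_tail (b n) x y (m n) - scaled_tail (b n) x y (mu n)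
  - (tail_expansion (b n) x y (m n) - tail_expansion (b n) x y (mu n)).
have s2 : 0 < Num.sqrt 2 :> R by rewrite sqrtr_gt0.
have s22 : Num.sqrt 2 ^+ 2 = 2 :> R by rewrite sqr_sqrtr.
have b0 : \forall n \near \oo, 0 < b n by move/cvgryPgt : b_oo; apply.
have mul : mu n @[n --> \oo] --> l := jet_cvg he jmu.
have mu0 : \forall n \near \oo, 0 < mu n by exact: cvgr_gt mul _ l0.
have mul1 : \forall n \near \oo, mu n <= l + 1.
  by apply: cvgr_le mul _ _; rewrite ltrDl.
have bl : \forall n \near \oo, (l + 1) * Num.sqrt 2 <= b n by move/cvgryPge : b_oo; apply.
have jrem : jet e rem 0 0 0.
  apply: jet_negligible => //.
  have i0 : K / Num.sqrt 2 * (b n)^-1 @[n --> \oo] --> (0 : R).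
    rewrite -(mulr0 (K / Num.sqrt 2)); apply: cvgM; first exact: cvg_cst.
    exact/gtr0_cvgV0.
  apply: norm_cvg0; apply: (@squeeze_cvgr _ _ _ _ (cst 0) _ _ _ _ _ i0); last exact: cvg_cst.
  near=> n; have bn : 0 < b n by near: n.
  have mun : 0 < mu n by near: n.
  have mum : mu n <= m n.
    rewrite /m ler_pdivlMr//.
    have h1 : mu n <= l + 1 by near: n.
    have h2 : (l + 1) * Num.sqrt 2 <= b n by near: n.
    by apply: le_trans h2; rewrite ler_wpM2r// ltW.
  have bnn : b n != 0 by rewrite gt_eqF.
  have m2 : 2 * m n ^+ 2 <= b n ^+ 2.
    by rewrite /m expr_div_n s22 mulrC divfK.
  have := hK (b n) (mu n) (m n) mun mum m2 bn; rewrite -/(rem n) => h.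
  have e2 : 0 < e n ^+ 2 by rewrite /e exprn_gt0// invr_gt0 exprn_gt0.
  rewrite normr_ge0/= normrM normfV (gtr0_norm e2) ler_pdivrMr//.
  apply: le_trans h _; rewrite le_eqVlt; apply/orP; left; apply/eqP.
  by rewrite /m /e; field; rewrite bnn gt_eqF.
have J := jet_add (jet_add je (jet_opp jrem)) jm.
apply: jet_near_eq (jet_eq J _ _ _); [|ring..].
apply: nearW => n; rewrite /rem /m.
move: (scaled_tail _ _ _ _) (scaled_tail _ _ _ (mu n)) => A B.
by move: (tail_expansion _ _ _ _) (tail_expansion _ _ _ (mu n)) => C D; ring.
Unshelve. all: by end_near. Qed.

(** * The n-th power *)

Lemma Phibar_anti (R : realType) (s t : R) : s <= t -> Phibar t <= Phibar s.
Proof.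
rewrite le_eqVlt => /orP[/eqP->//|st].
by rewrite /Phibar lerD2l lerN2 ltW// Phi_incr.
Qed.

(** If b_n < A, then n (1 - Phi(b_n)) >= n (1 - Phi(A)), which exceeds 1 for large n. *)
Lemma cvgy_of_tail (R : realType) (b : nat -> R) :
  (forall n : nat, (3 <= n)%N -> n%:R * (1 - Phi (b n)) = 1) ->
  b n @[n --> \oo] --> +oo.
Proof.
move=> hb; apply/cvgryPge => A.
have n3 : \forall n \near \oo, (3 <= n)%N by exact: nbhs_infty_ge.
have nA : \forall n \near \oo, (Phibar A)^-1 < n%:R.
  by have /cvgryPgt := @cvgr_idn R; apply.
near=> n; have hn : (3 <= n)%N by near: n.
have An : (Phibar A)^-1 < n%:R by near: n.
rewrite leNgt; apply/negP => /ltW /Phibar_anti h.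
have P0 := Phibar_gt0 A; have := hb n hn; rewrite -/(Phibar _) => E.
have n0 : (0 : R) < n%:R by rewrite (lt_trans _ An)// invr_gt0.
have : 1 < n%:R * Phibar A.
  by rewrite -ltr_pdivrMr// div1r.
have : n%:R * Phibar A <= n%:R * Phibar (b n) by rewrite ler_pM2l.
by rewrite E; lra.
Unshelve. all: by end_near. Qed.

(** ln(1 + s) <= s, applied at s = - t and, for the inverse of 1 - t, at s = t / (1 - t). *)
Lemma ln_1B_bounds (R : realType) (t : R) : `|t| <= 1 / 2 ->
  `|ln (1 - t) + t| <= 2 * t ^+ 2.
Proof.
move=> th; have /andP[t1 t2] : - (1 / 2) <= t <= 1 / 2 by rewrite -ler_norml.
have p0 : 0 < 1 - t by lra.
have U : ln (1 - t) <= - t by apply: le_ln1Dx; lra.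
have L : - (t / (1 - t)) <= ln (1 - t).
  rewrite lerNl -lnV ?posrE//.
  rewrite [X in ln X](_ : _ = 1 + t / (1 - t)); last by field; rewrite gt_eqF.
  apply: le_ln1Dx; rewrite ltr_pdivlMr//; lra.
have q : t / (1 - t) - t <= 2 * t ^+ 2.
  have -> : t / (1 - t) - t = t ^+ 2 / (1 - t) by field; rewrite gt_eqF.
  rewrite ler_pdivrMr//; have := sqr_ge0 t; nra.
by rewrite ler_norml; have := sqr_ge0 t; lra.
Qed.

(** n ln(1 - h / n) = - h + O(h^2 / n), and 1 / n = 1 - Phi(b_n) is smaller than every power of
    eps. *)
Lemma jet_power (R : realType) (b h : nat -> R) (h0 h1 h2 : R) :
  b n @[n --> \oo] --> +oo ->
  (forall n : nat, (3 <= n)%N -> n%:R * (1 - Phi (b n)) = 1) ->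
  jet (fun n => (b n ^+ 2)^-1) h h0 h1 h2 ->
  jet (fun n => (b n ^+ 2)^-1) (fun n => (1 - h n / n%:R) ^+ n)
    (expR (- h0)) (expR (- h0) * - h1) (expR (- h0) * (- h2 + h1 ^+ 2 / 2)).
Proof.
move=> b_oo hb; set e := fun n => _ => jh.
have he : small_scale e := small_scale_inv_sqr b_oo.
have hh := jet_cvg he jh.
have n3 : \forall n \near \oo, (3 <= n)%N by exact: nbhs_infty_ge.
pose w n : R := Phibar (b n).
have dw : jet e (fun n => Phibar (b n + 0 / (2 * b n))) 0 0 0.
  apply: (@jet_fast_decay _ b b _ 1 b_oo); first by move=> n; rewrite mul1r.
  exact: fast_decay_Phibar.
have wE n : (3 <= n)%N -> w n = n%:R^-1.
  move=> n3'; have := hb n n3'; rewrite -/(Phibar _) -/(w n) => E.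
  have n0 : n%:R != 0 :> R by rewrite pnatr_eq0 -lt0n (leq_trans _ n3').
  by apply: (mulfI n0); rewrite E mulfV.
have jw : jet e w 0 0 0.
  by apply: jet_near_eq dw; apply: nearW => n; rewrite mul0r addr0.
have t0 : h n * w n @[n --> \oo] --> (0 : R).
  by rewrite -(mulr0 h0); apply: cvgM => //; exact: jet_cvg he jw.
have tsmall : \forall n \near \oo, `|h n * w n| <= 1 / 2.
  by move/cvgr0Pnorm_le : t0; apply.
pose rem n := n%:R * (ln (1 - h n * w n) + h n * w n).
have jrem : jet e rem 0 0 0.
  apply: jet_negligible => //.
  have i0 : 2 * (h n * h n) * (w n / e n ^+ 2) @[n --> \oo] --> (0 : R).
    rewrite -(mulr0 (2 * (h0 * h0))); apply: cvgM.
      by apply: cvgM; [exact: cvg_cst|exact: cvgM].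
    have [r ra wE'] := jet_expansion he jw.
    apply: cvg_trans ra; apply: near_eq_cvg; near=> n.
    have -> : w n = 0 + 0 * e n + r n * e n ^+ 2 by near: n.
    have en : e n != 0 by near: n; exact: he.2.
    by field.
  apply: norm_cvg0; apply: (@squeeze_cvgr _ _ _ _ (cst 0) _ _ _ _ _ i0); last exact: cvg_cst.
  near=> n; have en : e n != 0 by near: n; exact: he.2.
  have hn : (3 <= n)%N by near: n.
  have tn : `|h n * w n| <= 1 / 2 by near: n.
  have n0 : (0 : R) < n%:R by rewrite ltr0n (leq_trans _ hn).
  have e2 : 0 < e n ^+ 2 by rewrite exprn_even_gt0.
  rewrite normr_ge0/= normrM normfV (gtr0_norm e2) mulrA ler_pM2r ?invr_gt0//.
  rewrite /rem normrM (gtr0_norm n0) -ler_pdivlMl//.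
  apply: le_trans (ln_1B_bounds tn) _.
  rewrite le_eqVlt; apply/orP; left; apply/eqP.
  by rewrite (wE n hn); field; rewrite gt_eqF.
have J := jet_expR he (jet_add jrem (jet_opp jh)).
apply: jet_near_eq (jet_eq J _ _ _); rewrite ?add0r//; last first.
  by congr (_ * (_ + _)); rewrite sqrrN.
near=> n; have hn : (3 <= n)%N by near: n.
have tn : `|h n * w n| <= 1 / 2 by near: n.
have n0 : (0 : R) < n%:R by rewrite ltr0n (leq_trans _ hn).
have p0 : 0 < 1 - h n * w n.
  by have : h n * w n <= 1 / 2 := le_trans (ler_norm _) tn; lra.
rewrite -(wE n hn) -[in RHS](lnK p0) -expRM_natl; congr expR.
rewrite /rem mulrDr -addrA [X in _ + X](_ : _ = 0) ?addr0//.
by rewrite (wE n hn) mulrCA mulfV ?mulr1 ?subrr// gt_eqF.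
Unshelve. all: by end_near. Qed.

Unset Implicit Arguments.

(** * Assembly and comparison with kappa and tau *)

Theorem theorem2p2 (R : realType) (b rho : nat -> R) (lam alpha beta : R)
  (hb : forall n : nat, (3 <= n)%N -> n%:R * (1 - Phi (b n)) = 1)
  (hrho : forall n : nat, -1 <= rho n <= 1)
  (hlam : 0 < lam)
  (hdelta : b n ^+ 2 * delta_seq b rho alpha lam n @[n --> \oo] --> beta) :
  forall x y : R,
    b n ^+ 2
      * (b n ^+ 2
           * (bigauss_cdf (rho n) (u_seq b n x) (u_seq b n y) ^+ n - H lam x y)
         - kappa alpha lam x y * H lam x y)
      @[n --> \oo]
    --> (tau alpha beta lam x y + 1 / 2 * kappa alpha lam x y ^+ 2)
        * H lam x y.
Proof.
move=> x y.
have b_oo := cvgy_of_tail hb.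
pose e n := (b n ^+ 2)^-1; have he : small_scale e := small_scale_inv_sqr b_oo.
pose mu n := lambda_seq b rho n.
(* The hypothesis on delta_n says lambda_n = lam - alpha eps - beta eps^2 + o(eps^2). *)
have jmu : jet e mu lam (- alpha) (- beta).
  rewrite /jet (_ : (fun n => _) = (fun n => - (b n ^+ 2 * delta_seq b rho alpha lam n))).
    exact: cvgN.
  by apply/funext => n; rewrite /delta_seq /e /mu !invrK; ring.
have js := jet_scaled_tail b_oo hlam jmu (jet_tail_expansion (x := x) (y := y) b_oo hlam jmu).
(* At z = 0 the scaled tail is b / (n phi(b)), so n (1 - F) is [scaled_tail] divided by it. *)
have j0 := jet_scaled_Phibar (z := 0) b_oo.
have p00 : pol1 0 = - 1 :> R by rewrite /pol1; field.
have p20 : pol2 0 = 3 :> R by rewrite /pol2; field.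
rewrite oppr0 expR0 p00 p20 !mulr1 in j0.
have jh := jet_mul he (jet_inv he (oner_neq0 R) j0) js.
have jp := jet_power b_oo hb jh.
have n3 : \forall n \near \oo, (3 <= n)%N by exact: nbhs_infty_ge.
have b0 : \forall n \near \oo, 0 < b n by move/cvgryPgt : b_oo; apply.
have HE : H lam x y = expR (- tail_term0 x y lam).
  rewrite /H /tail_term0 /tail_sum; congr expR.
  by move: (Phi _) (Phi _) (phi _) => P Q p; ring.
have ln : lam != 0 by rewrite gt_eqF.
have jF : jet e (fun n => bigauss_cdf (rho n) (u_seq b n x) (u_seq b n y) ^+ n)
    (H lam x y) (kappa alpha lam x y * H lam x y)
    ((tau alpha beta lam x y + 1 / 2 * kappa alpha lam x y ^+ 2) * H lam x y).
  apply: jet_near_eq (jet_eq jp _ _ _).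
  - near=> n; have hn : (3 <= n)%N by near: n.
    have bn : 0 < b n by near: n.
    have n0 : n%:R != 0 :> R by rewrite pnatr_eq0 -lt0n (leq_trans _ hn).
    (* rho_n <= 1 makes the radicand of lambda_n nonnegative, so the parametrization gives back
       rho_n. *)
    have rE : 1 - 2 * mu n ^+ 2 / b n ^+ 2 = rho n.
      rewrite /mu /lambda_seq sqr_sqrtr; first by field; rewrite gt_eqF.
      have /andP[_ r1] := hrho n.
      by rewrite mulr_ge0 ?subr_ge0// mulr_ge0// sqr_ge0.
    congr (_ ^+ n); rewrite /scaled_tail rE /scaled_Phibar mul0r addr0.
    have E : n%:R * Phibar (b n) = 1 := hb n hn.
    have bn0 : b n != 0 by rewrite gt_eqF.
    have ph : phi (b n) != 0 by rewrite gt_eqF ?phi_gt0.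
    have pb : Phibar (b n) != 0 by rewrite gt_eqF ?Phibar_gt0.
    rewrite -/(u_seq b n x) -/(u_seq b n y).
    move: (bigauss_cdf _ _ _) => F; move: E ph pb; move: (phi _) (Phibar _) => p P E ph pb.
    have -> : (n%:R)^-1 = P by apply: (mulfI n0); rewrite E mulfV.
    by field; rewrite bn0 ph pb.
  - by rewrite HE invr1 mul1r.
  - rewrite invr1 !mul1r [LHS]mulrC; congr (_ * _); last by symmetry; exact: HE.
    rewrite /kappa /s /tail_term0 /tail_term1 /tail_sum /tail_density /pol1 /mid1.
    by move: (Phi _) (Phi _) (phi _) (expR _) (expR _) => P Q p E F; field.
  - rewrite invr1 !mul1r [LHS]mulrC; congr (_ * _); last by symmetry; exact: HE.
    rewrite /tau /tau1 /tau2 /tau3 /Phibar /kappa /s /tail_term0 /tail_term1 /tail_term2 /tail_sum.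
    rewrite /tail_density /pol1 /pol2 /mid1 /mid2 /density_coef1 /density_rate.
    (* With [Phi], [phi] and the exponentials as indeterminates, the second-order coefficients agree
       as rational functions whose only denominators are powers of lam and numerals. *)
    by move: (Phi _) (Phi _) (phi _) (expR _) (expR _) => P Q p E F; field.
move: jF; rewrite /jet /e.
rewrite (_ : (fun n => ((_ - _) / _ - _) / _) = (fun n => b n ^+ 2
      * (b n ^+ 2
           * (bigauss_cdf (rho n) (u_seq b n x) (u_seq b n y) ^+ n - H lam x y)
         - kappa alpha lam x y * H lam x y)))//.
by apply/funext => n; rewrite !invrK mulrC; congr (_ * (_ - _)); rewrite mulrC.
Unshelve. all: by end_near. Qed.
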